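(* Let $\{W(t),t\in\mathbb{R}\}$ be one-dimensional standard Brownian motion, $p>0$, $b>0$, $v\in p\mathbb{Z}$ with $v>b+16$, and $k\in\mathbb{N}$. Let $\lambda^{(p)}$, $Z_{4,\lambda^{(p)}}$, $Z_{4,\lambda^{(p)}}^{(k;v;p)}$, $Y_k^{(p)}$, $C_k$ be as defined in the context and let $c(k)<0$ be a real number. Then $$\mathbb{P}\big(Z_{4,\lambda^{(p)}}^{(k;v;p)}(t)\neq Z_{4,\lambda^{(p)}}(t)\text{ for some }t\in[-b,b]\cap p\mathbb{Z}\ \big|\ Y_k^{(p)}\leq c(k),\,C_k>c(k)\big)$$ $$\leq16e^{-c(k)}\left(1-e^{-\frac p2}\right)^{-2}\lambda^{(p)}\Bigg(\exp\left(-\sqrt{v-b}\right)+\frac8{\sqrt{2\pi}}\left(1+\frac1{\sqrt{v-b}-4}\right)\exp\left(-\frac{(\sqrt{v-b}-4)^2}8\right)$$ $$+\frac{100\sqrt{b^3}}{9\sqrt\pi}\exp\left(-\frac{(\sqrt{v-b}-\log(\sqrt{v-b}))^2}{4b}\right)\Bigg).$$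
   Context: Standard Brownian motion on $\mathbb{R}$ is two-sided with $W(0)=0$ and $\mathrm{Var}(W(t))=|t|$. Definition of $\lambda^{(p)}$ and $Q^{(p)}$: let $W_i$ be independent copies of $W$ and $\sum_i\delta_{X_i}$ an independent Poisson point process on $\mathbb{R}$ with intensity measure $e^{-x}dx$. Put $T_i^{(p)}=\inf\big(\mathrm{argsup}_{t\in p\mathbb{Z}}(W_i(t)-\frac{|t|}2)\big)$, $M_i^{(p)}=\sup_{t\in p\mathbb{Z}}(W_i(t)-\frac{|t|}2)$, $F_i^{(p)}(t)=W_i(t+T_i^{(p)})-\frac{|t+T_i^{(p)}|}2-M_i^{(p)}$ for $t\in p\mathbb{Z}$. Then $\sum_i\delta_{(T_i^{(p)},X_i+M_i^{(p)},F_i^{(p)})}$ is a Poisson point process on $p\mathbb{Z}\times\mathbb{R}\times\mathbb{R}^{p\mathbb{Z}}$ with intensity measure $\lambda^{(p)}p\sum_{t\in p\mathbb{Z}}\delta_t\times e^{-u}du\times Q^{(p)}(dF)$, where $\lambda^{(p)}>0$ and $Q^{(p)}$ is a probability measure; this determines both. The measure $Q^{(p)}$ is the law of $(W(t)-\frac{|t|}2)_{t\in p\mathbb{Z}}$ conditioned on $T^{(p)}=0$, where $T^{(p)}=\inf\big(\mathrm{argsup}_{t\in p\mathbb{Z}}(W(t)-\frac{|t|}2)\big)$. Let $\sum_i\delta_{(R_i,Y_i^{(p)})}$ and $\sum_i\delta_{(r_i,y_i^{(p)})}$ be independent Poisson point processes on $([-v,v]\cap p\mathbb{Z})\times\mathbb{R}$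 and $(p\mathbb{Z}\setminus[-v,v])\times\mathbb{R}$, respectively, each with intensity measure $p\lambda^{(p)}\sum_r\delta_r\times e^{-u}du$ (sum over the grid points $r$ in question), indexed so that $Y_1^{(p)}>Y_2^{(p)}>\cdots$ (the points of the second process are enumerated in any way). Let $\tilde F_i,\tilde f_i$, $i\in\mathbb{N}$, be i.i.d. with law $Q^{(p)}$, independent of these processes. For $t\in p\mathbb{Z}$ put $$Z_{4,\lambda^{(p)}}(t)=\max\Big\{\max_{i\in\mathbb{N}}\big(Y_i^{(p)}+\tilde F_i(t-R_i)\big),\ \max_{i\in\mathbb{N}}\big(y_i^{(p)}+\tilde f_i(t-r_i)\big)\Big\},\qquad Z_{4,\lambda^{(p)}}^{(k;v;p)}(t)=\max_{i=1,\ldots,k}\big(Y_i^{(p)}+\tilde F_i(t-R_i)\big),$$ and $C_k:=\min_{t\in[-b,b]\cap p\mathbb{Z}}Z_{4,\lambda^{(p)}}^{(k;v;p)}(t)$. *)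

(* Defs.v *)
From HB Require Import structures.
From mathcomp Require Export all_boot all_order all_algebra.
From mathcomp Require Export all_classical all_reals all_analysis.
From mathcomp Require Export measurable_realfun.
Export Order.TTheory GRing.Theory Num.Theory.
Export numFieldNormedType.Exports.

Set Implicit Arguments.
Unset Strict Implicit.
Unset Printing Implicit Defensive.

Local Open Scope classical_set_scope.
Local Open Scope ring_scope.

Section independence.
Context {d : measure_display} {Omega : measurableType d} {R : realType}.
Variable P : probability Omega R.

Definition sigma_of {I : Type} {d' : measure_display} {S : measurableType d'}
    (D : set I) (X : I -> Omega -> S) : set (set Omega) :=
  <<s \bigcup_(i in D) preimage_set_system setT (X i) measurable >>.

Definition mutual_indep {I : eqType} (G : I -> set (set Omega)) : Prop :=
  forall (J : seq I) (E : I -> set Omega), uniq J ->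
    (forall i, i \in J -> G i (E i)) ->
    P (\bigcap_(i in [set` J]) E i) = (\prod_(i <- J) P (E i))%E.

(* Conditional probability; it is 0 by convention when [P B = 0]. *)
Definition cond_prob (A B : set Omega) : R := fine (P (A `&` B)) / fine (P B).

End independence.

Section point_process.
Context {d d' : measure_display} {Omega : measurableType d}
  {S : measurableType d'} {R : realType}.
Variable P : probability Omega R.

(* Number of points of [sum_i delta_(xi i)] in [A]. *)
Definition pp_count (xi : nat -> Omega -> S) (A : set S) (w : Omega) : \bar R :=
  (\sum_(i <oo) \d_(xi i w) A)%E.

Definition sigma_pp (xi : nat -> Omega -> S) : set (set Omega) :=
  sigma_of measurable (pp_count xi).

(* Poisson point processes with infinitely many points, enumerated by [nat].
   The second argument of the library's [poisson_prob] is unused, and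
   [poisson_prob 0 _] is the Dirac mass at 0. *)
Definition is_PPP (xi : nat -> Omega -> S) (mu : set S -> \bar R) : Prop :=
  [/\ forall i, measurable_fun setT (xi i),
      forall A, measurable A -> (mu A < +oo)%E -> forall n : nat,
        P [set w | pp_count xi A w = n%:R%:E] =
          poisson_prob (fine (mu A)) 0%N [set n],
      forall A, measurable A -> mu A = +oo%E ->
        {ae P, forall w, pp_count xi A w = +oo%E}
    & forall A : nat -> set S, (forall j, measurable (A j)) ->
        trivIset setT A ->
        mutual_indep P (fun j => sigma_of [set A j] (pp_count xi)) ].

End point_process.

Arguments sigma_pp {d d' Omega S} R xi.

Section brownian.
Context {d : measure_display} {Omega : measurableType d} {R : realType}.
Variable P : probability Omega R.

(* Standard two-sided Brownian motion. [normal_prob m s] has variance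
   [s ^+ 2]. *)
Definition is_BM (W : R -> Omega -> R) : Prop :=
  [/\ forall t, measurable_fun setT (W t),
      {ae P, forall w, W 0 w = 0},
      {ae P, forall w, continuous (W ^~ w)},
      forall s t, s < t -> forall B, measurable B ->
        P [set w | B (W t w - W s w)] = normal_prob 0 (Num.sqrt (t - s)) B
    & forall s : nat -> R, (forall j, s j < s j.+1) ->
        mutual_indep P (fun j =>
          sigma_of [set tt] (fun _ w => W (s j.+1) w - W (s j) w)) ].

End brownian.

Section grid.
Context {R : realType}.
Implicit Types (p v t : R) (f : R -> R) (D : set R).

(* The grid pZ. *)
Definition grid p : set R := [set p * n%:~R | n in [set: int]].

Definition grid_in p v : set R := grid p `&` `[- v, v].
Definition grid_out p v : set R := grid p `\` `[- v, v].

(* The space R^(pZ) of paths on the grid: a path is given by a function on R,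
   of which the sigma-algebra only sees the values at grid points. *)
Definition grid_path p : Type :=
  g_sigma_algebraType
    [set C : set (R -> R) | exists t (B : set R),
      [/\ grid p t, measurable B & C = [set f | B (f t)]]].

Definition drifted (w : R -> R) : R -> R := fun t => w t - `|t| / 2.

Definition argsup D f : set R := [set t | D t /\ forall s, D s -> f s <= f t].

Definition argT p f : R := inf (argsup (grid p) f).
Definition maxM p f : R := sup (f @` grid p).
Definition shapeF p f : grid_path p := fun t => f (t + argT p f) - maxM p f.

(* [sum_(t in D) delta_t] *)
Definition sum_dirac D (A : set R) : \bar R := counting (A `&` D).

(* [e^(-u) du] *)
Definition exp_meas (A : set R) : \bar R :=
  (\int[lebesgue_measure]_(u in A) (expR (- u))%:E)%E.

(* [a * (sum_(t in D) delta_t) x (e^(-u) du)] *)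
Definition grid_intensity (a : R) D (A : set (R * R)) : \bar R :=
  (a%:E * (sum_dirac D \x exp_meas) A)%E.

End grid.

(* [lam] and [Q] are lambda^(p) and Q^(p): the points
   (T_i, X_i + M_i, F_i) built from independent Brownian motions [W i] and an
   independent Poisson point process [sum_i delta_(X i)] form a Poisson point
   process of intensity [lam * p * sum_t delta_t x e^(-u) du x Q]. *)
Definition is_lambda_Q {d : measure_display} {Omega : measurableType d}
    {R : realType} (P : probability Omega R) (W : nat -> R -> Omega -> R)
    (X : nat -> Omega -> R) (p lam : R) (Q : probability (grid_path p) R) :
    Prop :=
  let f i w := drifted (W i ^~ w) in
  [/\ forall i, is_BM P (W i),
      is_PPP P X exp_meas,
      mutual_indep P (fun o : option nat =>
        if o is Some i then sigma_of setT (W i) else sigma_of setT X),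
      0 < lam
    & is_PPP P
        (fun i w => (argT p (f i w), X i w + maxM p (f i w), shapeF p (f i w)))
        (grid_intensity (lam * p) (grid p) \x Q)%E ].

Section max_process.
Context {d : measure_display} {Omega : measurableType d} {R : realType}.
Context {p : R}.

(* Points are indexed from 0, so the first k of them are [i < k]. *)
Definition Zk (k : nat) (Rp Y : nat -> Omega -> R)
    (F : nat -> Omega -> grid_path p) (t : R) (w : Omega) : \bar R :=
  (\big[maxe/-oo]_(i < k) (Y i w + F i w (t - Rp i w))%:E)%E.

Definition Zfull (Rp Y rp y : nat -> Omega -> R)
    (F f : nat -> Omega -> grid_path p) (t : R) (w : Omega) : \bar R :=
  maxe
    (ereal_sup (range (fun i => (Y i w + F i w (t - Rp i w))%:E)))
    (ereal_sup (range (fun i => (y i w + f i w (t - rp i w))%:E))).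

Definition Ck (b : R) (k : nat) (Rp Y : nat -> Omega -> R)
    (F : nat -> Omega -> grid_path p) (w : Omega) : \bar R :=
  ereal_inf [set Zk k Rp Y F t w | t in grid_in p b].

End max_process.

(* The joint law of the data: [(Rp i, Y i)] is the process on
   [-v, v], [(rp i, y i)] the one off [-v, v], and [F i], [f i] are the
   i.i.d. paths. The enumeration of the second process is arbitrary, but the
   paths are independent of the enumerated points. *)
Definition is_max_data {d : measure_display} {Omega : measurableType d}
    {R : realType} (P : probability Omega R) (p v lam : R)
    (Q : probability (grid_path p) R) (Rp Y rp y : nat -> Omega -> R)
    (F f : nat -> Omega -> grid_path p) : Prop :=
  let N i w := (Rp i w, Y i w) in
  let n i w := (rp i w, y i w) in
  let has_law_Q (G : Omega -> grid_path p) := measurable_fun setT G /\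
    forall B : set (grid_path p), measurable B -> P (G @^-1` B) = Q B in
  [/\ [/\ forall i w, grid_in p v (Rp i w),
          is_PPP P N (grid_intensity (p * lam) (grid_in p v))
        & {ae P, forall w i, Y i.+1 w < Y i w}],
      (forall i w, grid_out p v (rp i w)) /\
        is_PPP P n (grid_intensity (p * lam) (grid_out p v)),
      mutual_indep P (fun c : bool => if c then sigma_pp R N else sigma_pp R n),
      forall i, has_law_Q (F i) /\ has_law_Q (f i)
    & mutual_indep P (fun o : option (nat + nat) =>
        match o with
        | None => sigma_of setT (fun ci : nat + nat =>
                    match ci with inl i => N i | inr i => n i end)
        | Some (inl i) => sigma_of [set tt] (fun _ => F i)
        | Some (inr i) => sigma_of [set tt] (fun _ => f i)
        end) ].

(* Main.v *)
Require Import Defs.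
From HB Require Import structures.
From mathcomp Require finmap.
From mathcomp Require Import ring lra zify.

(** Write [f] for the drifted Brownian path [W t - |t| / 2], [D] for [v - b],
    [B] for the conditioning event and [q] for the conditional probability.

    On [B] the points of the first process beyond the [k] highest have height at
    most [c], and paths under [Q] are nonpositive on the grid ([shape_nonpos]).
    So if the two maxima differ at some [t] with [|t| <= b], then
    [y_j + f_j (t - r_j) > c] for some point of the second process
    ([exceed_of_neq]).  The second process and its paths are independent of [B]
    ([first_info_indep]; up to null sets [B] is an event of the point process
    and the paths, because the decreasing heights let one recover the
    enumeration from counts of points).  Hence [q] is at most the mean number
    of such marked points, summed over [t], which by Campbell's formula
    ([campbell], [second_slices]) is
    [sum_t sum_(|r| > v) lam p (e^(-u) du x Q) {(u, F) : u + F (t - r) > c}].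

    A summand depends on [r - t] only, and [|r - t| > D].  The definition of
    [lam] and [Q] evaluates it: a point [(T, X + M, F)] of the process that
    defines them satisfies [X + M + F (- T) = X + f 0 = X], so for a fixed [t]
    the sum is at most the mean number of points with [X > c] and [|T| > D],
    that is [e^(-c)] times the probability that [|T| > D] ([far_slices]).
    If [|T| > D] then [f] is nonnegative somewhere beyond [D]; as [exp (f / 2)]
    is a supermartingale with mean [exp (- |t| / 8)], Ville's maximal inequality
    ([ville]) bounds that probability by [2 exp (- D / 8)] ([far_up_le]).
    Altogether [q <= (2 b / p + 1) 2 e^(-D / 8) e^(-c)] ([union_bound]).

    The bound to be proved contains [lam], so a lower bound on [lam] is needed.
    The same process gives it: each grid point carries mass [lam p] of points of
    positive height, while the argsup lies within distance about 12 of the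
    origin with probability at least 1/2, so [1 <= 2 (24 + p) lam]
    ([lambda_lower], [lambda_ge]).  It remains to compare explicit functions of
    [p], [b] and [D] ([tail_sum_ge]): the Gaussian summand is
    [e^(-D / 8)] times a multiple of [exp (sqrt D - 2)], which suffices for
    [b < 2], and for [b >= 2] the last summand is at least [7 b e^(-D / 8)],
    which pays for the number of grid points. *)

Set Implicit Arguments.
Unset Strict Implicit.
Unset Printing Implicit Defensive.

Local Open Scope classical_set_scope.
Local Open Scope ring_scope.

(** * Independence of generated sigma-algebras *)

Section independence_tools.
Context {d : measure_display} {Omega : measurableType d} {R : realType}.
Variable P : probability Omega R.

(** The sets independent of a fixed [H] form a Dynkin system. *)
Lemma indep_generated (Pi : set (set Omega)) (H : set Omega) :
  setI_closed Pi -> Pi `<=` measurable -> measurable H ->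
  (forall A, Pi A -> P (A `&` H) = (P A * P H)%E) ->
  forall A, <<s Pi >> A -> P (A `&` H) = (P A * P H)%E.
Proof.
move=> PiI Pim mH PiH.
pose G := [set A | measurable A /\ P (A `&` H) = (P A * P H)%E].
suff dG : dynkin G.
  move=> A; rewrite -(setI_closed_g_dynkin_g_sigma_algebra PiI).
  by move=> /(_ G) []//; split=> // B PiB; split; [exact: Pim|exact: PiH].
split.
- by split; [exact: measurableT|rewrite setTI probability_setT mul1e].
- move=> A [mA PA]; split; first exact: measurableC.
  rewrite setIC -setDE measureD//; last by rewrite ltey_eq fin_num_measure.
  transitivity (P H - P A * P H)%E; first by rewrite -PA setIC.
  by rewrite probability_setC// muleBl ?fin_num_measure// mul1e.
- move=> F tF GF; split.
    by apply: bigcup_measurable => k _; have [] := GF k.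
  rewrite setI_bigcupl measure_bigcup//=; last 2 first.
  - by move=> k _; apply: measurableI => //; have [] := GF k.
  - exact: trivIset_setIr.
  rewrite measure_bigcup//; last by move=> k _; have [] := GF k.
  have [h hE] : exists h, P H = h%:E.
    by exists (fine (P H)); rewrite fineK ?fin_num_measure.
  rewrite hE muleC -nneseriesZl//.
  by apply: eq_eseriesr => k _; rewrite -hE muleC; have [] := GF k.
Qed.

Definition finite_cap {I : eqType} (G : I -> set (set Omega)) (D : set I) :
    set (set Omega) :=
  [set A | exists (s : seq I) (E : I -> set Omega),
    [/\ uniq s, forall i, i \in s -> D i /\ G i (E i)
      & A = \bigcap_(i in [set` s]) E i]].

Section finite_cap.
Context {I : eqType} (G : I -> set (set Omega)).
Hypothesis GI : forall i, setI_closed (G i).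
Hypothesis GT : forall i, G i setT.

Lemma finite_cap_setI D : setI_closed (finite_cap G D).
Proof.
move=> _ _ [s [E [us sE ->]]] [s' [E' [us' sE' ->]]].
exists (undup (s ++ s')), (fun i => (if i \in s then E i else setT) `&`
  (if i \in s' then E' i else setT)); split; first exact: undup_uniq.
  move=> i; rewrite mem_undup mem_cat => iss'; split.
    by case/orP: iss' => [/sE|/sE'] [].
  by apply: GI; case: ifPn => // si; [have [] := sE i si|have [] := sE' i si].
apply/seteqP; split => w /=.
  move=> [ws ws'] i _; split; first by case: ifPn => // /ws.
  by case: ifPn => // /ws'.
move=> ww; split => i is_.
  have [|] := ww i; first by rewrite /= mem_undup mem_cat is_.
  by rewrite is_.
have [|] := ww i; first by rewrite /= mem_undup mem_cat is_ orbT.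
by rewrite is_.
Qed.

Lemma sub_finite_cap (D : set I) : \bigcup_(i in D) G i `<=` finite_cap G D.
Proof.
move=> A [i Di GA]; exists [:: i], (fun=> A); split => //.
  by move=> j; rewrite inE => /eqP ->.
by apply/seteqP; split => [w Aw j _//|w /(_ i)]; apply; rewrite /= inE.
Qed.

Hypothesis Gm : forall i, G i `<=` measurable.

Lemma finite_cap_measurable D : finite_cap G D `<=` measurable.
Proof.
move=> _ [s [E [us sE ->]]]; apply: fin_bigcap_measurable; last first.
  by move=> i /= /sE[_ /Gm].
exact: finite_seq.
Qed.

(** Both sides reduce to finite intersections of members of the families, and
    there the product rule applies to the concatenation of the index lists. *)
Lemma mutual_indep_groups (D1 D2 : set I) : mutual_indep P G ->
  (forall i, D1 i -> D2 i -> False) ->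
  forall A B, <<s \bigcup_(i in D1) G i >> A -> <<s \bigcup_(i in D2) G i >> B ->
  P (A `&` B) = (P A * P B)%E.
Proof.
move=> indG D12 A B /(sub_sigma_algebra2 (@sub_finite_cap D1)) GA.
move=> /(sub_sigma_algebra2 (@sub_finite_cap D2)) GB.
have mA : measurable A.
  apply: (smallest_sub _ _ GA); first exact: sigma_algebra_measurable.
  exact: finite_cap_measurable.
apply: (@indep_generated (finite_cap G D1)) => //.
- exact: finite_cap_setI.
- exact: finite_cap_measurable.
- apply: (smallest_sub _ _ GB); first exact: sigma_algebra_measurable.
  exact: finite_cap_measurable.
- move=> {mA GA}A capA.
  rewrite setIC muleC.
  apply: (@indep_generated (finite_cap G D2)) => //.
  + exact: finite_cap_setI.
  + exact: finite_cap_measurable.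
  + exact: finite_cap_measurable capA.
  case: capA => s [E [us sE ->]] {GB}B [s' [E' [us' sE' ->]]].
  have dis i : i \in s -> i \in s' -> False.
    by move=> /sE[+ _] /sE'[+ _]; exact: D12.
  rewrite (indG s) //; last by move=> i /sE[].
  rewrite (indG s')//; last by move=> i /sE'[].
  pose F i := if i \in s then E i else E' i.
  have F' i : i \in s' -> F i = E' i.
    by rewrite /F; case: ifPn => // si /(dis _ si).
  rewrite (_ : _ `&` _ = \bigcap_(i in [set` s' ++ s]) F i).
    rewrite (indG (s' ++ s)).
    - rewrite big_cat/=; congr (_ * _)%E; rewrite !big_seq; apply: eq_bigr => i si.
        by rewrite F'.
      by rewrite /F si.
    - rewrite cat_uniq us us' andbT/=; apply/hasPn => i si; apply/negP.
      exact: dis.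
    - move=> i; rewrite mem_cat => /orP[si|si].
        by rewrite F'//; have [] := sE' i si.
      by rewrite /F si; have [] := sE i si.
  apply/seteqP; split => w /=.
    move=> [ws' ws] i; rewrite /= mem_cat => /orP[si|si].
      by rewrite F'//; exact: ws'.
    by rewrite /F si; exact: ws.
  move=> ww; split=> i si.
    by rewrite -F'//; apply: ww; rewrite /= mem_cat (si : i \in s').
  have := ww i; rewrite /F (si : i \in s); apply.
  by rewrite /= mem_cat (si : i \in s) orbT.
Qed.

End finite_cap.

Lemma sigma_of_algebra {I : Type} {d' : measure_display} {S : measurableType d'}
    (D : set I) (X : I -> Omega -> S) : sigma_algebra setT (sigma_of D X).
Proof. exact: smallest_sigma_algebra. Qed.

Lemma sigma_ofI {I : Type} {d' : measure_display} {S : measurableType d'}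
    (D : set I) (X : I -> Omega -> S) : setI_closed (sigma_of D X).
Proof.
by have /sigma_algebraP[//|_ _ _] := sigma_of_algebra D X.
Qed.

Lemma sigma_ofT {I : Type} {d' : measure_display} {S : measurableType d'}
    (D : set I) (X : I -> Omega -> S) : sigma_of D X setT.
Proof. by have /sigma_algebraP[//|? _ _] := sigma_of_algebra D X. Qed.

Lemma sigma_of_preimage {I : Type} {d' : measure_display} {S : measurableType d'}
    (D : set I) (X : I -> Omega -> S) i B : D i -> measurable B ->
  sigma_of D X (X i @^-1` B).
Proof.
move=> Di mB; apply: sub_sigma_algebra; exists i => //.
by exists B => //; rewrite setTI.
Qed.

Lemma sigma_of_measurable {I : Type} {d' : measure_display}
    {S : measurableType d'} (D : set I) (X : I -> Omega -> S) :
  (forall i, D i -> measurable_fun setT (X i)) -> sigma_of D X `<=` measurable.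
Proof.
move=> mX; apply: smallest_sub; first exact: sigma_algebra_measurable.
by move=> _ [i Di [B mB <-]]; apply: mX.
Qed.

End independence_tools.

(** * Mean measure of a Poisson point process *)

Section poisson_mean.
Context {R : realType}.
Local Open Scope ereal_scope.

Lemma poisson_prob_mass (r : R) :
  \sum_(n <oo) poisson_prob r 0%N [set n] = 1.
Proof.
transitivity (poisson_prob r 0%N (\bigcup_n [set n])); last first.
  rewrite (_ : \bigcup_n _ = setT) ?probability_setT//.
  by apply/seteqP; split => // n _; exists n.
rewrite measure_bigcup//=; first by apply: eq_eseriesl => n; rewrite in_setT.
by move=> i j _ _ [n [-> ->]].
Qed.

Lemma poisson_mean (r : R) : (0 <= r)%R ->
  \sum_(n <oo) n%:R%:E * poisson_prob r 0%N [set n] = r%:E.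
Proof.
rewrite le_eqVlt => /orP[/eqP <-|r0].
  apply: eseries0 => n _ _; rewrite /poisson_prob ltxx.
  by case: n => [|n]; rewrite ?mul0e// diracE memNset ?mule0.
have pS n : n.+1%:R%:E * poisson_prob r 0%N [set n.+1] =
            r%:E * poisson_prob r 0%N [set n] :> \bar R.
  rewrite /poisson_prob r0 !esum_set1 ?lee_fin ?poisson_pmf_ge0// -!EFinM.
  rewrite /poisson_pmf r0 factS natrM invfM exprS; congr _%:E.
  have n0 : (n.+1%:R : R) != 0%R by rewrite pnatr_eq0.
  have f0 : (n`!%:R : R) != 0%R by rewrite pnatr_eq0 -lt0n fact_gt0.
  by rewrite -natr1 in n0 *; field; rewrite f0.
apply/cvg_lim => //; rewrite -cvg_shiftS/=.
rewrite [X in X @ _ --> _](_ : _ =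
  (fun n => r%:E * \sum_(0 <= k < n) poisson_prob r 0%N [set k])); last first.
  apply/funext => n /=; rewrite big_nat_recl// mul0e add0e.
  under eq_bigr do rewrite pS.
  by rewrite ge0_sume_distrr.
suff : (fun n => \sum_(0 <= k < n) poisson_prob r 0%N [set k]) @ \oo --> 1.
  by move=> /(cvgeZl (isT : r%:E \is a fin_num)); rewrite mule1.
rewrite -(poisson_prob_mass r).
exact: is_cvg_nneseries.
Qed.
End poisson_mean.

Section campbell.
Context {d d' : measure_display} {Omega : measurableType d}
  {S : measurableType d'} {R : realType}.
Variable P : probability Omega R.
Local Open Scope ereal_scope.
Variables (xi : nat -> Omega -> S) (mxi : forall i, measurable_fun setT (xi i)).

Lemma pp_count_measurable A : measurable A ->
  measurable_fun setT (pp_count xi A : Omega -> \bar R).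
Proof.
move=> mA; apply: ge0_emeasurable_sum => // i _.
rewrite [X in measurable_fun _ X](_ : _ = (fun w => (\1_A (xi i w) : R)%:E)).
  apply/measurable_EFinP; exact: (measurableT_comp (measurable_indic mA) (mxi i)).

by apply/funext => w; rewrite diracE indicE.
Qed.

Lemma measurable_pp_count_eq A n : measurable A ->
  measurable [set w | pp_count xi A w = n :> \bar R].
Proof.
move=> mA; have := pp_count_measurable mA measurableT (emeasurable_set1 n).
by rewrite setTI.
Qed.

Lemma integral_pp_count B A : measurable B -> measurable A ->
  \int[P]_(w in B) pp_count xi A w = \sum_(i <oo) P (B `&` xi i @^-1` A).
Proof.
move=> mB mA; rewrite integral_nneseries//; last first.
  move=> i; apply: measurable_funTS.
  rewrite [X in measurable_fun _ X](_ : _ = (fun w => (\1_A (xi i w) : R)%:E)).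
    apply/measurable_EFinP; exact: (measurableT_comp (measurable_indic mA) (mxi i)).

  by apply/funext => w; rewrite diracE indicE.
apply: eq_eseriesr => i _.
rewrite (eq_integral (fun w => (\1_(xi i @^-1` A) w)%:E)); last first.
  by move=> w _; rewrite diracE indicE.
rewrite integral_indic// 1?setIC//.
by rewrite -[X in measurable X]setTI; exact: mxi.
Qed.

(** The number of points in [A] is integrated over [B] in two ways: point by
    point, and along its values, whose law is Poisson even on [B].  If [mu A] is
    infinite, so is almost surely the number of points. *)
Lemma campbell mu B : is_PPP P xi mu ->
  (forall A, measurable A -> 0 <= mu A) -> measurable B ->
  (forall A (n : nat), measurable A ->
    P (B `&` [set w | pp_count xi A w = n%:R%:E :> \bar R]) =
    P B * P [set w | pp_count xi A w = n%:R%:E :> \bar R]) ->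
  forall A, measurable A -> \sum_(i <oo) P (B `&` xi i @^-1` A) = P B * mu A.
Proof.
move=> [_ Pmu Pmuy _] mu0 mB indB A mA.
rewrite -integral_pp_count//.
have [muAy|] := eqVneq (mu A) +oo; last first.
  rewrite -ltey => muAy.
  pose U n := [set w | pp_count xi A w = n%:R%:E :> \bar R].
  have mU n : measurable (U n) by exact: measurable_pp_count_eq.
  have PBUn n : P (B `&` U n) =
      (fine (P B))%:E * poisson_prob (fine (mu A)) 0%N [set n].
    by rewrite [LHS]indB// [X in _ * X]Pmu// fineK ?fin_num_measure.
  have tU : trivIset setT (fun n => B `&` U n).
    move=> i j _ _ [w [[_ +] [_]]]; rewrite /U/= => ->.
    by move=> [] /eqP; rewrite eqr_nat => /eqP.
  have PBU : P (B `&` \bigcup_n U n) = P B.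
    rewrite setI_bigcupr measure_bigcup//; last first.
      by move=> n _; exact: measurableI.
    rewrite (eq_eseriesr (g := fun n =>
      (fine (P B))%:E * poisson_prob (fine (mu A)) 0%N [set n])); last first.
      by move=> n _; exact: PBUn.
    rewrite (@eq_eseriesl _ _ xpredT); last by move=> n; rewrite in_setT.
    by rewrite nneseriesZl// poisson_prob_mass mule1 fineK ?fin_num_measure.
  have mBU : measurable (B `&` \bigcup_n U n).
    by apply: measurableI => //; exact: bigcup_measurable.
  have mc D : measurable_fun D (pp_count xi A : Omega -> \bar R).
    by apply: measurable_funTS; exact: pp_count_measurable.
  have c0 w : 0 <= pp_count xi A w :> \bar R by apply: nneseries_ge0.
  have -> : B = (B `&` \bigcup_n U n) `|` (B `\` (\bigcup_n U n)).
    by rewrite setUIDK.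
  rewrite ge0_integral_setU//; last 2 first.
  - by apply: measurableD => //; exact: bigcup_measurable.
  - apply/disj_set2P; apply/seteqP; split => // w.
    by move=> [[_ ?] []].
  rewrite [X in _ + X]null_set_integral//; last 2 first.
  - by apply: measurableD => //; exact: bigcup_measurable.
  - rewrite measureD//; last 2 first.
    + exact: bigcup_measurable.
    + by rewrite ltey_eq fin_num_measure.
    transitivity (P B - P B); last by rewrite subee// fin_num_measure.
    by congr (_ - _); exact: PBU.
  rewrite adde0 setUIDK setI_bigcupr ge0_integral_bigcup//; last first.
    by move=> n; exact: measurableI.
  rewrite (eq_eseriesr (g := fun n => (fine (P B))%:E *
      (n%:R%:E * poisson_prob (fine (mu A)) 0%N [set n]))); last first.
    move=> n _; rewrite (eq_integral (cst n%:R%:E)); last first.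
      by move=> w; rewrite inE => -[_].
    rewrite integral_cst; last exact: measurableI.
    by rewrite muleCA; congr (_ * _); exact: PBUn.
  rewrite nneseriesZl; last by move=> n _; rewrite mule_ge0.
  rewrite poisson_mean ?fine_ge0 ?mu0// !fineK ?fin_num_measure//.
  by rewrite ge0_fin_numE// mu0.
have mc D : measurable_fun D (pp_count xi A : Omega -> \bar R).
  by apply: measurable_funTS; exact: pp_count_measurable.
have c0 w : 0 <= pp_count xi A w :> \bar R by apply: nneseries_ge0.
rewrite (@ge0_ae_eq_integral _ _ _ P B _ (cst +oo))//.
  by rewrite integral_cst// muAy muleC.
  by move=> x _; rewrite leey.
by apply: filterS (Pmuy A mA muAy) => w ->.
Qed.

End campbell.

(** * The intensity measures *)

Section exp_measure.
Context {R : realType}.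
Local Open Scope ereal_scope.

Lemma measurable_expRN D : measurable_fun D (fun u : R => (expR (- u))%:E).
Proof.
by apply: measurable_funTS; apply/measurable_EFinP; apply: measurableT_comp.
Qed.

Let exp_meas0 : exp_meas (set0 : set R) = 0.
Proof. by rewrite /exp_meas integral_set0. Qed.

Let exp_meas_ge0 (A : set R) : 0 <= exp_meas A.
Proof. by apply: integral_ge0 => u _; rewrite lee_fin expR_ge0. Qed.

Let exp_meas_sigma_additive : semi_sigma_additive (@exp_meas R).
Proof.
move=> A mA tA mUA; rewrite /exp_meas ge0_integral_bigcup//.
- apply: is_cvg_nneseries => n _ _; exact: exp_meas_ge0.
- exact: measurable_expRN.
Qed.

HB.instance Definition _ := isMeasure.Build _ _ _ (@exp_meas R)
  exp_meas0 exp_meas_ge0 exp_meas_sigma_additive.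

Lemma exp_meas_itvoy (x : R) : exp_meas `]x, +oo[ = (expR (- x))%:E.
Proof.
rewrite /exp_meas integral_itv_obnd_cbnd; last exact: measurable_expRN.
have cN : continuous (fun u : R => expR (- u)).
  move=> u; apply: continuous_comp; last exact: continuous_expR.
  exact: (@continuousN _ R^o).
rewrite (@ge0_continuous_FTC2y _ _ (fun u => - expR (- u))%R _ 0%R).
- by rewrite EFinN oppeK add0e.
- by move=> u _; exact: expR_ge0.
- exact: continuous_subspaceT.
- by rewrite -oppr0; apply: cvgN; exact: cvgr_expR.
- by move=> u _; exact: ex_derive.
- by apply/cvg_at_right_filter; apply: cvgN; exact: cN.
- move=> z _; rewrite derive1E.
  by rewrite deriveN// derive_val mulrN1 opprK.
Qed.

Let exp_meas_sigma_finite : sigma_finite setT (@exp_meas R).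
Proof.
exists (fun n => `](- n%:R)%R, +oo[%classic).
  apply/seteqP; split => // x _.
  have [n nx] : exists n : nat, (- x < n%:R)%R.
    exists (Num.bound `|x|%R).
    by rewrite (le_lt_trans (ler_norm _))// normrN archi_boundP.
  by exists n => //=; rewrite in_itv/= andbT ltrNl.
by move=> n; rewrite exp_meas_itvoy ltry.
Qed.

HB.instance Definition _ := Measure_isSigmaFinite.Build _ _ _ (@exp_meas R)
  exp_meas_sigma_finite.

End exp_measure.

Section intensity.
Context {R : realType} (a : R) (a0 : 0 <= a) (D : set R) (mD : measurable D).
Local Open Scope ereal_scope.

(** [grid_intensity a D] is convertible to this measure, so that product
    measures can be formed with it. *)
Definition intensity_measure : {measure set (R * R) -> \bar R} :=
  mscale (NngNum a0) (mrestr counting mD \x @exp_meas R).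

Lemma grid_intensityE : grid_intensity a D = intensity_measure.
Proof. by []. Qed.

Lemma grid_intensity_ge0 A : 0 <= grid_intensity a D A.
Proof. by rewrite grid_intensityE. Qed.

Lemma grid_intensity_slice r A : D r -> measurable A ->
  grid_intensity a D ([set r] `*` A) = a%:E * exp_meas A.
Proof.
move=> Dr mA; rewrite grid_intensityE /= /mscale/= product_measure1E//.
rewrite /= /mrestr setIidl; last by move=> _ ->.
by rewrite /counting asboolT// fset_set1 finmap.cardfs1 mul1e.
Qed.

Context {d : measure_display} {G : measurableType d} (Q : probability G R).

Lemma marked_intensity_ge0 A : 0 <= (grid_intensity a D \x Q) A.
Proof. by rewrite grid_intensityE. Qed.

Lemma marked_intensity_slice r A B : D r -> measurable A -> measurable B ->
  (grid_intensity a D \x Q) (([set r] `*` A) `*` B) = a%:E * (exp_meas A * Q B).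
Proof.
move=> Dr mA mB; rewrite grid_intensityE product_measure1E//; last first.
  exact: measurableX.
by rewrite -grid_intensityE grid_intensity_slice// muleA.
Qed.

End intensity.

Section joint_law.
Context {d d' : measure_display} {Omega : measurableType d}
  {G : measurableType d'} {R : realType}.
Variables (P : probability Omega R) (Q : probability G R).
Local Open Scope ereal_scope.

(** Both sides are measures in [C] that agree on rectangles. *)
Lemma series_joint_law (a : R) (E : nat -> set Omega) (Y : nat -> Omega -> R)
    (F : nat -> Omega -> G) :
  (0 < a)%R -> (forall i, measurable (E i)) ->
  (forall i, measurable_fun setT (Y i)) ->
  (forall i, measurable_fun setT (F i)) ->
  (forall A B, measurable A -> measurable B ->
    \sum_(i <oo) P (E i `&` (Y i @^-1` A `&` F i @^-1` B)) =
    a%:E * (exp_meas A * Q B)) ->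
  forall C, measurable C ->
    \sum_(i <oo) P (E i `&` [set w | C (Y i w, F i w)]) =
    a%:E * (exp_meas \x Q) C.
Proof.
move=> a0 mE mY mF rect C mC.
have mZ i : measurable_fun setT (fun w => (Y i w, F i w)).
  exact/measurable_fun_pair.
have [m mE'] : exists m : nat -> {measure set (R * G) -> \bar R},
    forall i C', m i C' = P (E i `&` [set w | C' (Y i w, F i w)]).
  unshelve eexists (fun i =>
    (pushforward (mrestr P (mE i)) (fun w => (Y i w, F i w)))); last first.
    by move=> i C'; rewrite /= /pushforward /mrestr setIC.
  exact: mZ.
have ai0 : (0 <= a^-1)%R by rewrite invr_ge0 ltW.
under eq_eseriesr do rewrite -mE'.
rewrite -[LHS]/(mseries m 0 C) (@product_measure_unique _ _ _ _ _ _ _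
  (mscale (NngNum ai0) (mseries m 0)))//=.
  by rewrite /mscale/= muleA -EFinM divff ?mul1e// gt_eqF.
move=> A B mA mB; rewrite /= /mscale/= /mseries.
under eq_eseriesr do rewrite mE'.
rewrite rect// muleA -EFinM mulVf ?mul1e//.
by rewrite gt_eqF.
Qed.

End joint_law.

(** * Exponential moments and a maximal inequality *)

Section normal_mgf.
Context {R : realType}.
Local Open Scope ereal_scope.
Notation mu := (@lebesgue_measure R).

Lemma integral_normal_prob (s : R) (g : R -> \bar R) :
  (forall x, 0 <= g x) -> measurable_fun setT g ->
  \int[normal_prob 0%R s]_x g x = \int[mu]_x (g x * (normal_pdf 0%R s x)%:E).
Proof.
move=> g0 mg; have dom := normal_prob_dominates (0%R : R) s.
rewrite -(Radon_Nikodym_SigmaFinite.change_of_variables dom)//.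
have intRN := Radon_Nikodym_SigmaFinite.f_integrable dom.
apply: ae_eq_integral => //.
- by apply: emeasurable_funM => //; exact: measurable_int intRN.
- apply: emeasurable_funM => //; apply/measurable_EFinP.
  exact: measurable_normal_pdf.
- apply: ae_eqe_mul2l => /=; apply: integral_ae_eq => //=.
  + by apply/measurable_EFinP; exact: measurable_normal_pdf.
  + by move=> E _ mE; rewrite -Radon_Nikodym_SigmaFinite.f_integral.
Qed.

(** Completing the square: the factor [exp (th * x)] moves the mean of the
    density to [th * s ^+ 2]. *)
Lemma normal_mgf (s th : R) : (0 < s)%R ->
  \int[normal_prob 0%R s]_x (expR (th * x))%:E = (expR (th ^+ 2 * s ^+ 2 / 2))%:E.
Proof.
move=> s0; rewrite integral_normal_prob; last 2 first.
- by move=> x; rewrite lee_fin expR_ge0.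
- by apply/measurable_EFinP; apply: measurableT_comp => //; exact: measurable_funM.
have pdfE x : (expR (th * x))%:E * (normal_pdf 0%R s x)%:E =
   (expR (th ^+ 2 * s ^+ 2 / 2))%:E * (normal_pdf (th * s ^+ 2) s x)%:E.
  rewrite -!EFinM !normal_pdfE ?gt_eqF// /normal_fun; congr _%:E.
  rewrite mulrCA [RHS]mulrCA -!expRD; congr (_ * expR _)%R.
  by field; rewrite gt_eqF.
under eq_integral do rewrite pdfE.
rewrite ge0_integralZl//; last 2 first.
- by apply/measurable_EFinP; exact: measurable_normal_pdf.
- by move=> x _; rewrite lee_fin normal_pdf_ge0.
by rewrite integral_normal_pdf mule1.
Qed.

End normal_mgf.

Section product_expectation.
Context {d : measure_display} {Omega : measurableType d} {R : realType}.
Variable P : probability Omega R.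
Local Open Scope ereal_scope.

Lemma expectation_law {d' : measure_display} {T : measurableType d'}
    (X : Omega -> T) (m : {measure set T -> \bar R}) (g : T -> \bar R) :
  measurable_fun setT X -> measurable_fun setT g -> (forall x, 0 <= g x) ->
  (forall B, measurable B -> P (X @^-1` B) = m B) ->
  \int[P]_w g (X w) = \int[m]_x g x.
Proof.
move=> mX mg g0 PX.
rewrite -(@eq_measure_integral _ _ _ setT m (pushforward P X)); last first.
  by move=> B mB _; exact: PX.
by rewrite ge0_integral_pushforward.
Qed.

(** The joint law is the product of the marginal laws, so Tonelli's theorem
    applies. *)
Lemma expectation_indepM (U V : Omega -> R) :
  measurable_fun setT U -> measurable_fun setT V ->
  (forall w, 0 <= U w)%R -> (forall w, 0 <= V w)%R ->
  (forall A B, measurable A -> measurable B ->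
    P (U @^-1` A `&` V @^-1` B) = P (U @^-1` A) * P (V @^-1` B)) ->
  \int[P]_w (U w * V w)%:E = (\int[P]_w (U w)%:E) * (\int[P]_w (V w)%:E).
Proof.
move=> mU mV U0 V0 UV.
have mUV : measurable_fun setT (fun w => (U w, V w)).
  exact/measurable_fun_pair.
pose U' : {RV P >-> R} := mfun_Sub (mem_set mU).
pose V' : {RV P >-> R} := mfun_Sub (mem_set mV).
pose UV' : {RV P >-> (R * R)%type} := mfun_Sub (mem_set mUV).
pose g (x : R) : \bar R := (Num.max x 0%R)%:E.
have mg : measurable_fun setT g.
  by apply/measurable_EFinP; exact: measurable_maxr.
have g0 x : 0 <= g x by rewrite lee_fin le_max lexx orbT.
have gE x : (0 <= x)%R -> g x = x%:E by move=> x0; rewrite /g max_l.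
have prodE : \int[P]_w (U w * V w)%:E =
    \int[distribution P U' \x distribution P V']_z (g z.1 * g z.2).
  transitivity (\int[distribution P UV']_z (g z.1 * g z.2)).
    rewrite ge0_integral_distribution//=.
    - by apply: eq_integral => w _ /=; rewrite !gE.
    - by apply: emeasurable_funM; apply: measurableT_comp.
    - by move=> z; rewrite mule_ge0.
  apply: eq_measure_integral => A mA _; apply/esym.
  apply: product_measure_unique => // B C mB mC.
rewrite prodE fubini_tonelli1//; last 2 first.
- by apply: emeasurable_funM; apply: measurableT_comp.
- by move=> z; rewrite mule_ge0.
rewrite /fubini_F/=.
under eq_integral do rewrite ge0_integralZl//=.
rewrite ge0_integralZr//; last exact: integral_ge0.
congr (_ * _).
- rewrite ge0_integral_distribution//.
  by apply: eq_integral => w _ /=; rewrite gE.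
- rewrite ge0_integral_distribution//.
  by apply: eq_integral => w _ /=; rewrite gE.
Qed.

End product_expectation.

Section ville.
Context {d : measure_display} {Omega : measurableType d} {R : realType}.
Variable P : probability Omega R.
Variable A : nat -> Omega -> R.
Hypothesis mA : forall n, measurable_fun setT (A n).
Hypothesis A_ge0 : forall n w, 0 <= A n w.

Let G n := sigma_of [set tt] (fun _ : unit => A n).
Let Fil n := \bigcup_(i in [set i | (i <= n)%N]) G i.

Hypothesis indA : forall n S B, <<s Fil n >> S -> measurable B ->
  P (S `&` A n.+1 @^-1` B) = (P S * P (A n.+1 @^-1` B))%E.
Hypothesis EA : forall n, (\int[P]_w (A n.+1 w)%:E <= 1)%E.

(** The product [A 0 * ... * A n], killed once it has reached 1 at an earlier
    time. *)
Fixpoint stopped n w : R :=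
  if n is n'.+1 then
    (if stopped n' w < 1 then stopped n' w else 0) * A n'.+1 w
  else A 0%N w.

Let live n w := if stopped n w < 1 then stopped n w else 0.

Let stopped_ge0 n w : 0 <= stopped n w.
Proof. by elim: n => [|n ih] //=; rewrite mulr_ge0//; case: ifP. Qed.

Let live_ge0 n w : 0 <= live n w.
Proof. by rewrite /live; case: ifP. Qed.

Let measurable_A i n : (i <= n)%N ->
  measurable_fun setT (A i : g_sigma_algebraType (Fil n) -> R).
Proof.
move=> ni _ B mB; rewrite setTI; apply: sub_sigma_algebra; exists i => //.
exact: (@sigma_of_preimage _ _ _ _ _ _ _ tt).
Qed.

Let measurable_lt1 d' (T : measurableType d') (U : T -> R) :
  measurable_fun setT U -> measurable_fun setT (fun w => if U w < 1 then U w else 0).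
Proof.
move=> mU; apply: measurable_fun_ifT => //.
exact: measurable_fun_ltr.
Qed.

Let measurable_stopped i n : (i <= n)%N ->
  measurable_fun setT (stopped i : g_sigma_algebraType (Fil n) -> R).
Proof.
elim: i => [|i ih] ni; first exact: measurable_A.
apply: measurable_funM; last exact: measurable_A.
by apply: measurable_lt1; apply: ih; exact: ltnW.
Qed.

Let mstopped n : measurable_fun setT (stopped n).
Proof.
elim: n => [|n ih]; first exact: mA.
by apply: measurable_funM => //; exact: measurable_lt1.
Qed.

Let mlive n : measurable_fun setT (live n).
Proof. exact: measurable_lt1. Qed.

Let E_stoppedS n :
  (\int[P]_w (stopped n.+1 w)%:E <= \int[P]_w (live n w)%:E)%E.
Proof.
rewrite [leLHS](_ : _ = \int[P]_w (live n w * A n.+1 w)%:E)%E//.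
rewrite expectation_indepM//; last first.
  move=> B C mB mC; apply: indA => //.
  have := measurable_lt1 (measurable_stopped (leqnn n)) measurableT mB.
  by rewrite setTI.
rewrite -[leRHS]mule1; apply: lee_wpmul2l => //.
by apply: integral_ge0 => w _; rewrite lee_fin.
Qed.

Let E_split n : (P [set w | (1 <= stopped n w)%R] + \int[P]_w (live n w)%:E <=
  \int[P]_w (stopped n w)%:E)%E.
Proof.
have mS : measurable [set w | 1 <= stopped n w].
  have := mstopped n measurableT (measurable_itv `[1, +oo[).
  by rewrite setTI; congr measurable; apply/seteqP; split => w /=;
    rewrite in_itv/= andbT.
rewrite -[X in P X]setIT -integral_indic// -ge0_integralD//; last 3 first.
- by apply/measurable_EFinP; exact: measurable_indic.
- by move=> w _; rewrite lee_fin.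
- by apply/measurable_EFinP.
apply: ge0_le_integral => //.
- by move=> w _; rewrite adde_ge0// lee_fin.
- by apply: emeasurable_funD; apply/measurable_EFinP.
- by apply/measurable_EFinP.
- move=> w _; rewrite -EFinD lee_fin indicE /live; case: ifPn => h.
    by rewrite memNset ?add0r//= ; apply/negP; rewrite -ltNge.
  by rewrite addr0 mem_set//= leNgt.
Qed.

(** At each time the expectation of the surviving part drops by at least the
    probability of reaching 1 just then. *)
Let E_partial n : (\sum_(k < n.+1) P [set w | (1 <= stopped k w)%R] +
  \int[P]_w (live n w)%:E <= \int[P]_w (A 0%N w)%:E)%E.
Proof.
elim: n => [|n ih]; first by rewrite big_ord1; exact: (E_split 0).
rewrite big_ord_recr/= -addeA; apply: le_trans ih; rewrite leeD2l//.
exact: (le_trans (E_split n.+1) (E_stoppedS n)).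
Qed.

(** Ville's inequality: the products of the [A i] form a nonnegative
    supermartingale. *)
Lemma ville : exists2 N, measurable N & (P N <= \int[P]_w (A 0%N w)%:E)%E /\
  [set w | exists n, 1 <= \prod_(i < n.+1) A i w] `<=` N.
Proof.
have mS n : measurable [set w | 1 <= stopped n w].
  have := mstopped n measurableT (measurable_itv `[1, +oo[).
  by rewrite setTI; congr measurable; apply/seteqP; split => w /=;
    rewrite in_itv/= andbT.
exists (\bigcup_n [set w | 1 <= stopped n w]); first exact: bigcup_measurable.
split.
  apply: (@le_trans _ _ (\sum_(n <oo) P [set w | (1 <= stopped n w)%R])%E).
    by apply: measure_sigma_subadditive => //; exact: bigcup_measurable.
  apply: lime_le; first exact: is_cvg_nneseries.
  apply: nearW => n; rewrite big_mkord.
  apply: le_trans (E_partial n); rewrite big_ord_recr/= -addeA leeDl//.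
  by rewrite adde_ge0// integral_ge0// => w _; rewrite lee_fin.
move=> w [n0 Yn0].
have [n Yn min] := @ex_minnP (fun n => 1 <= \prod_(i < n.+1) A i w)
  (ex_intro _ n0 Yn0).
have sY k : (k <= n)%N -> stopped k w = \prod_(i < k.+1) A i w.
  elim: k => [|k ih] kn; first by rewrite big_ord1.
  rewrite big_ord_recr/= -ih; last exact: ltnW.
  rewrite ifT// ih; last exact: ltnW.
  by rewrite ltNge; apply/negP => /min; rewrite leqNgt kn.
by exists n => //=; rewrite sY.
Qed.

End ville.

(** * Brownian motion with drift, far from the origin *)

Section sigma_of_extra.
Context {d : measure_display} {Omega : measurableType d}.

Lemma sub_sigma_of {I J : Type} {d1 d2 : measure_display}
    {S1 : measurableType d1} {S2 : measurableType d2} (D1 : set I) (D2 : set J)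
    (X : I -> Omega -> S1) (Y : J -> Omega -> S2) :
  (forall i B, D1 i -> measurable B -> sigma_of D2 Y (X i @^-1` B)) ->
  sigma_of D1 X `<=` sigma_of D2 Y.
Proof.
move=> XY; apply: smallest_sub; first exact: sigma_of_algebra.
by move=> _ [i Di [B mB <-]]; rewrite setTI; exact: XY.
Qed.

Lemma sigma_of_comp {d1 d2 : measure_display}
    {S1 : measurableType d1} {S2 : measurableType d2} (X : Omega -> S1)
    (h : S1 -> S2) : measurable_fun setT h ->
  sigma_of [set tt] (fun=> h \o X) `<=` sigma_of [set tt] (fun=> X).
Proof.
move=> mh; apply: sub_sigma_of => _ B _ mB; rewrite comp_preimage.
apply: (@sigma_of_preimage _ _ _ _ _ _ _ tt) => //.
by have := mh measurableT B mB; rewrite setTI.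
Qed.

Lemma sub_bigcup_sigma {I J : Type} (D1 : set I) (D2 : set J)
    (G1 : I -> set (set Omega)) (G2 : J -> set (set Omega)) (h : I -> J) :
  (forall i, D1 i -> D2 (h i) /\ G1 i `<=` G2 (h i)) ->
  <<s \bigcup_(i in D1) G1 i >> `<=` <<s \bigcup_(j in D2) G2 j >>.
Proof.
move=> G12; apply: sub_sigma_algebra2 => A [i Di GA].
by have [Dh Gh] := G12 i Di; exists (h i) => //; exact: Gh.
Qed.

End sigma_of_extra.

Section gaussian_walk.
Context {d : measure_display} {Omega : measurableType d} {R : realType}.
Variable P : probability Omega R.
Variables (xi : nat -> Omega -> R) (dl : nat -> R).
Hypothesis mxi : forall j, measurable_fun setT (xi j).
Hypothesis dl_gt0 : forall j, 0 < dl j.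
Hypothesis Exi : forall j,
  (\int[P]_w (expR (xi j w / 2))%:E = (expR (dl j / 8))%:E)%E.
Hypothesis indxi : forall n S B,
  <<s \bigcup_(i in [set i | (i <= n)%N]) sigma_of [set tt] (fun _ : unit => xi i) >> S ->
  measurable B -> P (S `&` xi n.+1 @^-1` B) = (P S * P (xi n.+1 @^-1` B))%E.

(** The factors [exp ((xi j - dl j / 2) / 2)] have mean [exp (- dl j / 8)],
    hence at most 1. *)
Lemma gaussian_walk_ville : exists2 N, measurable N &
  (P N <= (expR (- (dl 0%N / 8)))%:E)%E /\
  [set w | exists n, 0 <= \sum_(i < n.+1) (xi i w - dl i / 2)] `<=` N.
Proof.
pose h j (x : R) := expR ((x - dl j / 2) / 2).
have mh j : measurable_fun setT (h j).
  apply: measurableT_comp => //; apply: measurable_funM => //.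
  exact: measurable_funB.
pose A j := h j \o xi j.
have mA j : measurable_fun setT (A j) by exact: measurableT_comp.
have EA j : (\int[P]_w (A j w)%:E = (expR (- (dl j / 8)))%:E)%E.
  have AE w : ((A j w)%:E = (expR (- (dl j / 4)))%:E * (expR (xi j w / 2))%:E)%E.
    by rewrite -EFinM -expRD /A /= /h; congr (expR _)%:E; field.
  under eq_integral do rewrite AE.
  rewrite ge0_integralZl//.
  - by rewrite Exi -EFinM -expRD; congr (expR _)%:E; field.
  - apply/measurable_EFinP; apply: measurableT_comp => //.
    exact: measurable_funM.
have [|||N mN [PN subN]] := @ville _ _ _ P A mA.
- by move=> n w; exact: expR_ge0.
- move=> n S B FS mB; rewrite /A comp_preimage; apply: indxi.
    move: S FS; apply: (sub_bigcup_sigma (h := id)) => i ni; split => //.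
    exact: sigma_of_comp.
  by have := mh n.+1 measurableT B mB; rewrite setTI.
- by move=> n; rewrite EA lee_fin expR_le1 oppr_le0 divr_ge0// ltW.
exists N => //; rewrite -EA; split => //.
apply: subset_trans subN => w [n Sn]; exists n.
rewrite /A /= /h -expR_sum -[leLHS]expR0 ler_expR -mulr_suml.
by rewrite divr_ge0.
Qed.

End gaussian_walk.

Section brownian_ville.
Context {d : measure_display} {Omega : measurableType d} {R : realType}.
Variable P : probability Omega R.
Variables (W : R -> Omega -> R) (bmW : is_BM P W).

Lemma BM_exp_increment s t th : s < t ->
  (\int[P]_w (expR (th * (W t w - W s w)))%:E =
   (expR (th ^+ 2 * (t - s) / 2))%:E)%E.
Proof.
move=> st; case: bmW => mW _ _ nW _.
rewrite (@expectation_law _ _ _ P _ (measurableTypeR R) (fun w => W t w - W s w)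
  (normal_prob 0 (Num.sqrt (t - s))) (fun x => (expR (th * x))%:E)).
- by rewrite normal_mgf ?sqrtr_gt0 ?subr_gt0// sqr_sqrtr// subr_ge0 ltW.
- exact: measurable_funB.
- by apply/measurable_EFinP; apply: measurableT_comp => //; exact: measurable_funM.
- by move=> x; rewrite lee_fin expR_ge0.
- exact: nW.
Qed.

Variables (s : nat -> R) (s0 : s 0%N = 0) (sS : forall j, s j < s j.+1).

Let mW t : measurable_fun setT (W t). Proof. by case: bmW. Qed.

Lemma BM_ville_right : exists2 N, measurable N &
  (P N <= (expR (- (s 1%N / 8)))%:E)%E /\
  [set w | W 0 w = 0 /\ exists n, 0 <= W (s n.+1) w - s n.+1 / 2] `<=` N.
Proof.
have [||||N mN [PN subN]] := @gaussian_walk_ville _ _ _ P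
  (fun j w => W (s j.+1) w - W (s j) w) (fun j => s j.+1 - s j).
- by move=> j; exact: measurable_funB.
- by move=> j; rewrite subr_gt0.
- move=> j; under eq_integral do rewrite mulrC.
  by rewrite BM_exp_increment//; congr (expR _)%:E; field.
- move=> n S B FS mB; case: bmW => _ _ _ _ /(_ s sS) indW.
  apply: (@mutual_indep_groups _ _ _ P _ _ _ _ _ _ [set n.+1] indW) FS _.
  + by move=> i; exact: sigma_ofI.
  + by move=> i; exact: sigma_ofT.
  + move=> i; apply: sigma_of_measurable => _ _; exact: measurable_funB.
  + by move=> i /= ni E; rewrite (E : i = n.+1) ltnn in ni.
  + apply: sub_sigma_algebra; exists n.+1 => //.
    exact: (@sigma_of_preimage _ _ _ _ _ _ _ tt).
exists N => //; rewrite s0 subr0 in PN; split => //.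
apply: subset_trans subN => w [W0 [n Wn]]; exists n.
rewrite (_ : \sum_(i < _) _ = W (s n.+1) w - s n.+1 / 2)//.
rewrite sumrB -mulr_suml.
rewrite -(big_mkord xpredT (fun i => W (s i.+1) w - W (s i) w)).
rewrite -(big_mkord xpredT (fun i => s i.+1 - s i)).
by rewrite !telescope_sumr// s0 W0 !subr0.
Qed.

(** Time reversal: the times [- s n.+2 < ... < - s 0], continued by positive
    integers, are increasing, and their increments are the opposites of the
    leftward ones in reverse order. *)
Lemma BM_ville_left : exists2 N, measurable N &
  (P N <= (expR (- (s 1%N / 8)))%:E)%E /\
  [set w | W 0 w = 0 /\ exists n, 0 <= W (- s n.+1) w - s n.+1 / 2] `<=` N.
Proof.
have [||||N mN [PN subN]] := @gaussian_walk_ville _ _ _ P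
  (fun j w => W (- s j.+1) w - W (- s j) w) (fun j => s j.+1 - s j).
- by move=> j; exact: measurable_funB.
- by move=> j; rewrite subr_gt0.
- move=> j; have ss : - s j.+1 < - s j by rewrite ltrN2.
  under eq_integral do rewrite -opprB mulNr mulrC -mulNr.
  by rewrite BM_exp_increment//; congr (expR _)%:E; field.
- move=> n S B FS mB.
  (* The increment from [s' i] to [s' i.+1] is the opposite of the leftward one of
     index [n.+1 - i]. *)
  pose s' i := if (i <= n.+2)%N then - s (n.+2 - i)%N else (i - n.+2)%:R.
  have s'S i : s' i < s' i.+1.
    rewrite /s'; have [ni|ni|->] := ltngtP i n.+2.
    - by rewrite ltrN2 -(subnSK ni).
    - by rewrite ltr_nat subSn// ltnW.
    - by rewrite subnn s0 oppr0 subSnn.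
  case: bmW => _ _ _ _ /(_ s' s'S) indW.
  have s'E k : (k <= n.+2)%N -> s' (n.+2 - k)%N = - s k.
    by move=> kn; rewrite /s' leq_subr subKn.
  have xiE i : (i <= n.+1)%N -> (fun w => W (- s i.+1) w - W (- s i) w) =
      (fun x => - x) \o
      (fun w => W (s' (n.+1 - i).+1%N) w - W (s' (n.+1 - i)%N) w).
    move=> ni; apply/funext => w /=; rewrite opprB.
    rewrite (_ : (n.+1 - i).+1 = n.+2 - i)%N; last by rewrite [RHS]subSn.
    rewrite (_ : n.+1 - i = n.+2 - i.+1)%N; last by rewrite subSS.
    by rewrite !s'E// leqW.
  have := @mutual_indep_groups _ _ _ P _ _ _ _ _ [set i | (0 < i)%N]
    [set 0%N] indW. apply.
  + by move=> i; exact: sigma_ofI.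
  + by move=> i; exact: sigma_ofT.
  + move=> i; apply: sigma_of_measurable => _ _; exact: measurable_funB.
  + by move=> i /= ni E; rewrite (E : i = 0%N) in ni.
  + move: S FS; apply: (sub_bigcup_sigma (h := fun i => (n.+1 - i)%N)) => i /= ni.
    split; first by rewrite subn_gt0 ltnS.
    by rewrite xiE ?leqW//; apply: sigma_of_comp; exact: oppr_measurable.
  + apply: sub_sigma_algebra; exists 0%N => //.
    apply: (@sigma_of_comp _ _ _ _ _ _ _ (fun x : R => - x)).
      exact: oppr_measurable.
    rewrite -(subnn n.+1) -xiE//.
    exact: (@sigma_of_preimage _ _ _ _ _ _ _ tt).
exists N => //; rewrite s0 subr0 in PN; split => //.
apply: subset_trans subN => w [W0 [n Wn]]; exists n.
rewrite (_ : \sum_(i < _) _ = W (- s n.+1) w - s n.+1 / 2)//.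
rewrite sumrB -mulr_suml.
rewrite -(big_mkord xpredT (fun i => W (- s i.+1) w - W (- s i) w)).
rewrite -(big_mkord xpredT (fun i => s i.+1 - s i)).
rewrite (telescope_sumr (fun i => W (- s i) w))//.
by rewrite telescope_sumr// s0 oppr0 W0 subr0 addr0.
Qed.

End brownian_ville.

(** When this fails, the argsup has rank at most [m].  Unlike the argsup it is
    evidently an event of the path, hence independent of the heights. *)
Definition far_up {R : realType} (p : R) (m : nat) (f : R -> R) : Prop :=
  exists j : nat, (m < j)%N /\ (0 <= f (p * j%:R) \/ 0 <= f (- (p * j%:R))).

Section far_up.
Context {d : measure_display} {Omega : measurableType d} {R : realType}.
Variable P : probability Omega R.
Variables (W : R -> Omega -> R) (bmW : is_BM P W).
Variables (p : R) (p_gt0 : 0 < p).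

Let E m := [set w | far_up p m (drifted (W ^~ w))].

Lemma far_up_sigma m : sigma_of setT W (E m).
Proof.
have pre t : sigma_of setT W [set w | 0 <= drifted (W ^~ w) t].
  rewrite (_ : [set w | _] = W t @^-1` `[`|t| / 2, +oo[).
    exact: sigma_of_preimage.
  by apply/seteqP; split => w /=; rewrite in_itv/= andbT subr_ge0.
rewrite (_ : E m = \bigcup_j (if (m < j)%N then
   [set w | 0 <= drifted (W ^~ w) (p * j%:R)] `|`
   [set w | 0 <= drifted (W ^~ w) (- (p * j%:R))] else set0)).
  apply: sigma_algebra_bigcup => j; case: ifPn => _; last exact: sigma_algebra0.
  have [_ _ U] := @sigma_of_algebra _ Omega _ _ _ setT W.
  rewrite -bigcup2E; apply: U => -[|[|k]]; rewrite /bigcup2 /=.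
  - exact: pre.
  - exact: pre.
  - exact: sigma_algebra0.
apply/seteqP; split => w.
  by move=> [j [mj Ej]]; exists j => //; rewrite mj.
by move=> [j _]; case: ifPn => // mj Ej; exists j.
Qed.

Lemma far_up_measurable m : measurable (E m).
Proof.
apply: (sigma_of_measurable _ (far_up_sigma m)) => t _.
by case: bmW.
Qed.

(** The square root of [exp (drifted W)] has mean [exp (- |t| / 8)] at time [t];
    on each side it is started at the grid point of rank [m + 1]. *)
Lemma far_up_le m : (P (E m) <= (2 * expR (- (p * m.+1%:R / 8)))%:E)%E.
Proof.
pose s j : R := if j is j'.+1 then p * (m.+1 + j')%:R else 0.
have sS j : s j < s j.+1.
  case: j => [|j] /=; first by rewrite mulr_gt0// ltr0n.
  by rewrite ltr_pM2l// ltr_nat addnS.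
have [N1 mN1 [PN1 subN1]] := BM_ville_right bmW (erefl : s 0 = 0) sS.
have [N2 mN2 [PN2 subN2]] := BM_ville_left bmW (erefl : s 0 = 0) sS.
case: bmW => _ [N0 [mN0 PN0 subN0]] _ _ _.
have sub : E m `<=` N0 `|` (N1 `|` N2).
  move=> w [j [mj Ej]]; have [w0|] := pselect (N0 w); first by left.
  move=> /(contra_not (subN0 w)) /contrapT /= W0.
  have sj : s (j - m.+1).+1 = p * j%:R by rewrite /s subnKC.
  have sj0 : 0 <= p * j%:R by rewrite mulr_ge0// ltW.
  right; case: Ej => Ej; [left; apply: subN1|right; apply: subN2];
    split=> //; exists (j - m.+1)%N; rewrite sj; move: Ej; rewrite /drifted.
    by rewrite ger0_norm.
  by rewrite normrN ger0_norm.
have mN : measurable (N0 `|` (N1 `|` N2)).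
  by apply: measurableU => //; exact: measurableU.
apply: (@le_trans _ _ (P (N0 `|` (N1 `|` N2)))).
  by apply: le_measure => //; rewrite inE//; exact: far_up_measurable.
apply: (le_trans (measureU2 _ _ _)) => //; first exact: measurableU.
rewrite mulr_natl mulr2n EFinD -[leRHS]add0e.
apply: leeD; first by have -> : (0 = P N0)%E by rewrite PN0.
apply: (le_trans (measureU2 _ _ _)) => //.
by apply: leeD; [move: PN1|move: PN2]; rewrite /= addn0.
Qed.

(** The bound of [far_up_le] tends to 0: almost surely the path is negative at
    all but finitely many grid points. *)
Lemma far_up_eventually_null : P (\bigcap_m E m) = 0.
Proof.
have le_m m : (P (\bigcap_m E m) <= (2 * expR (- (p * m.+1%:R / 8)))%:E)%E.
  apply: le_trans (far_up_le m); apply: le_measure; rewrite ?inE.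
  - by apply: bigcapT_measurable => k; exact: far_up_measurable.
  - exact: far_up_measurable.
  - exact: bigcap_inf.
apply/eqP; rewrite eq_le measure_ge0 andbT.
have [x xE] : exists x, P (\bigcap_m E m) = x%:E.
  exists (fine (P (\bigcap_m E m))); rewrite fineK ?fin_num_measure//.
  by apply: bigcapT_measurable => k; exact: far_up_measurable.
rewrite xE lee_fin leNgt; apply/negP => x0.
pose m := Num.bound (16 / (p * x)).
have := le_m m; rewrite xE lee_fin leNgt => /negP; apply.
rewrite expRN ltr_pdivrMr ?expR_gt0//.
have : 16 / (p * x) < m%:R by rewrite archi_boundP// divr_ge0// mulr_ge0// ltW.
rewrite ltr_pdivrMr ?mulr_gt0// => mb.
have := expR_ge1Dx (p * m.+1%:R / 8); rewrite -natr1 => e1.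
apply: (@lt_le_trans _ _ (x * (1 + p * (m%:R + 1) / 8))); last first.
  by rewrite ler_pM2l.
have px : 0 < p * x by rewrite mulr_gt0.
clear e1 xE le_m; move: (m%:R : R) mb => M mb; nra.
Qed.

End far_up.

(** * The argsup on the grid *)

Section argsup_grid.
Context {R : realType}.
Variables (p : R) (p_gt0 : 0 < p).

Lemma gridP (n : int) : grid p (p * n%:~R).
Proof. by exists n. Qed.

Lemma grid0 : grid p 0.
Proof. by exists 0; rewrite // mulr0. Qed.

Lemma gridN t : grid p t -> grid p (- t).
Proof. by move=> [n _ <-]; exists (- n) => //; rewrite mulrNz mulrN. Qed.

Lemma gridD s t : grid p s -> grid p t -> grid p (s + t).
Proof.
by move=> [n _ <-] [m _ <-]; exists (n + m) => //; rewrite intrD mulrDr.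
Qed.

Lemma gridB s t : grid p s -> grid p t -> grid p (s - t).
Proof. by move=> ps /gridN; exact: gridD. Qed.

Lemma countable_grid : countable (grid p).
Proof. exact: sub_countable (card_image_le _ _) (countableP _). Qed.

Lemma measurable_grid : measurable (grid p).
Proof. exact: countable_measurable countable_grid. Qed.

Variable f : R -> R.

Lemma not_far_up_lt0 m t : ~ far_up p m f -> grid p t -> p * m%:R < `|t| -> f t < 0.
Proof.
move=> nf [n _ <-] mn; rewrite ltNge; apply/negP => ft0; apply: nf.
exists `|n|%N; split.
  by move: mn; rewrite normrM (gtr0_norm p_gt0) ltr_pM2l// -intr_norm -abszE -pmulrn ltr_nat.
by case: n ft0 {mn} => n /= ft; [left|right] => //; rewrite NegzE mulrNz mulrN in ft.
Qed.

(** Outside the window the path is below [f 0 = 0], so the supremum is a maximum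
    over the finite window, and the set of argsups, finite and nonempty, contains
    its infimum. *)
Lemma argsup_exists m : f 0 = 0 -> ~ far_up p m f ->
  [/\ grid p (argT p f), (forall s, grid p s -> f s <= f (argT p f)),
      maxM p f = f (argT p f) & `|argT p f| <= p * m%:R].
Proof.
move=> f0 nf.
pose g (j : 'I_(m + m).+1) : R := p * (j%:R - m%:R).
have gg j : grid p (g j).
  by exists (j%:Z - m%:Z) => //; rewrite intrB -!pmulrn.
have gP t : grid p t -> `|t| <= p * m%:R -> exists j, t = g j.
  move=> [n _ <-]; rewrite normrM (gtr0_norm p_gt0) ler_pM2l// -intr_norm -abszE -pmulrn.
  rewrite ler_nat => nm.
  have jm : (absz (n + m%:Z)%R < (m + m).+1)%N by lia.
  exists (Ordinal jm); rewrite /g /=; congr (_ * _).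
  rewrite pmulrn (_ : Posz (absz (n + m%:Z)) = n + m%:Z); last by lia.
  by rewrite intrD -pmulrn addrK.
have m0 : (m < (m + m).+1)%N by rewrite ltnS leq_addr.
have g0 : g (Ordinal m0) = 0 by rewrite /g subrr mulr0.
have far t : grid p t -> (exists j, t = g j) \/ f t < 0.
  move=> gt; have [|tm] := leP `|t| (p * m%:R); first by left; exact: gP.
  by right; exact: not_far_up_lt0 tm.
have [j0 _ j0max] := @Order.TotalTheory.arg_maxP _ _ _ (Ordinal m0) xpredT (f \o g) isT.
have fj0 : 0 <= f (g j0) by have := j0max (Ordinal m0) isT; rewrite /= g0 f0.
have max0 s : grid p s -> f s <= f (g j0).
  move=> gs; have [[j ->]|fs] := far s gs; first exact: j0max.
  by rewrite (le_trans (ltW fs)).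
have [j1 /eqP fj1 j1min] := @arg_minnP _ j0 (fun j => f (g j) == f (g j0))
   (fun j => nat_of_ord j) (eqxx _).
have TE : argT p f = g j1.
  apply/eqP; rewrite eq_le; apply/andP; split.
    apply: ge_inf; last by split=> // s gs; rewrite fj1; exact: max0.
    exists (- (p * m%:R)) => t [gt tmax].
    have [[j ->]|ft] := far t gt.
      by rewrite /g mulrBr lerBrDr addNr mulr_ge0// ltW.
    by move: ft; rewrite ltNge (le_trans fj0)// tmax.
  apply: lb_le_inf; first by exists (g j1); split=> // s gs; rewrite fj1; exact: max0.
  move=> t [gt tmax]; have [[j tj]|ft] := far t gt; last first.
    by move: ft; rewrite ltNge (le_trans fj0)// tmax.
  rewrite tj /g ler_pM2l// lerB// ler_nat; apply: j1min.
  by rewrite eq_le max0//= -tj tmax.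
rewrite TE; split => //.
- by move=> s gs; rewrite fj1; exact: max0.
- apply/eqP; rewrite eq_le; apply/andP; split.
    apply: ge_sup; first by exists (f (g j1)), (g j1).
    by move=> _ [s gs <-]; rewrite fj1; exact: max0.
  apply: sup_ubound; last by exists (g j1).
  by exists (f (g j0)) => _ [s gs <-]; exact: max0.
- rewrite /g normrM (gtr0_norm p_gt0) ler_pM2l// ler_norml.
  have := ltn_ord j1; rewrite ltnS -(ler_nat R) natrD => j1m.
  by rewrite lerBrDr addNr ler0n lerBlDr.
Qed.

End argsup_grid.

(** * The process that defines lambda and Q *)

Section grid_path_eval.
Context {R : realType} (p : R).

Lemma measurable_eval t : grid p t ->
  measurable_fun setT (fun F : grid_path p => F t).
Proof.
by move=> gt _ B mB; rewrite setTI; apply: sub_sigma_algebra; exists t, B.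
Qed.

(** A point at [r] with mark [z] contributes more than [c] at [t] when [z] lies in
    this set for [s = t - r]. *)
Definition exceed (c s : R) : set (R * grid_path p) :=
  [set z | c < z.1 + z.2 s].

Lemma measurable_exceed c s : grid p s -> measurable (exceed c s).
Proof.
move=> gs; rewrite (_ : exceed c s =
    (fun z : R * grid_path p => z.1 + z.2 s) @^-1` `]c, +oo[).
  rewrite -[X in measurable X]setTI; apply: measurable_funD => //.
  exact: measurableT_comp (measurable_eval gs) measurable_snd.
by apply/seteqP; split => z /=; rewrite in_itv/= andbT.
Qed.

End grid_path_eval.
Arguments exceed {R} p c s.

Section lambda_Q.
Context {R : realType} {d : measure_display} {Omega : measurableType d}.
Variable P : probability Omega R.
Variables (W : nat -> R -> Omega -> R) (X : nat -> Omega -> R).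
Variables (p lam : R) (Q : probability (grid_path p) R).
Hypothesis p_gt0 : 0 < p.
Hypothesis lamQ : is_lambda_Q P W X lam Q.
Local Open Scope ereal_scope.

Let f i w := drifted (W i ^~ w).
Let T i w := argT p (f i w).
Let M i w := maxM p (f i w).
Let F i w : grid_path p := shapeF p (f i w).
Let E i m := [set w | far_up p m (f i w)].

Let bmW i : is_BM P (W i). Proof. by case: lamQ. Qed.
Let pppX : is_PPP P X (@exp_meas R). Proof. by case: lamQ. Qed.
Let lam_gt0 : (0 < lam)%R. Proof. by case: lamQ. Qed.
Let lamp_gt0 : (0 < lam * p)%R. Proof. exact: mulr_gt0. Qed.
Let mX i : measurable_fun setT (X i). Proof. by case: pppX. Qed.

Let mxi i : measurable_fun setT (fun w => (T i w, (X i w + M i w)%R, F i w)).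
Proof. by case: lamQ => _ _ _ _ [H _ _ _]; exact: H. Qed.

Let mT i : measurable_fun setT (T i).
Proof. exact: (measurableT_comp measurable_fst (measurableT_comp measurable_fst (mxi i))). Qed.

Let mXM i : measurable_fun setT (fun w => X i w + M i w)%R.
Proof. exact: (measurableT_comp measurable_snd (measurableT_comp measurable_fst (mxi i))). Qed.

Let mF i : measurable_fun setT (F i).
Proof. exact: (measurableT_comp measurable_snd (mxi i)). Qed.

Let mTr i r : measurable [set w | T i w = r].
Proof. by have := mT i measurableT (measurable_set1 r); rewrite setTI. Qed.

Let mE i m : measurable (E i m).
Proof. exact: far_up_measurable. Qed.

Let slice_rect r A B : grid p r -> measurable A -> measurable B ->
  \sum_(i <oo) P ([set w | T i w = r] `&`
     ((fun w => X i w + M i w)%R @^-1` A `&` F i @^-1` B)) =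
  (lam * p)%:E * (exp_meas A * Q B).
Proof.
move=> gr mA mB.
have mg := @measurable_grid R p.
rewrite -(marked_intensity_slice (ltW lamp_gt0) mg Q gr mA mB).
case: lamQ => _ _ _ _ ppp.
have := @campbell _ _ _ _ _ P _ mxi _ setT ppp _ measurableT _ (([set r] `*` A) `*` B).
rewrite probability_setT mul1e => <-.
- by apply: eq_eseriesr => i _; congr (P _); apply/seteqP; split => w /=; tauto.
- by move=> C mC; exact: (marked_intensity_ge0 (ltW lamp_gt0) mg).
- by move=> C n mC; rewrite setTI mul1e.
- by apply: measurableX => //; apply: measurableX.
Qed.

Let slice r C : grid p r -> measurable C ->
  \sum_(i <oo) P ([set w | T i w = r] `&` [set w | C ((X i w + M i w)%R, F i w)]) =
  (lam * p)%:E * (exp_meas \x Q) C.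
Proof.
move=> gr mC.
apply: (@series_joint_law _ _ _ _ _ P Q (lam * p)%R (fun i => [set w | T i w = r])
  (fun i w => X i w + M i w)%R F) => //.
by move=> A B mA mB; exact: slice_rect.
Qed.

Let good i : exists2 N, measurable N & P N = 0 /\
  forall w, ~ N w -> f i w 0%R = 0%R /\ exists m, ~ far_up p m (f i w).
Proof.
have [_ [N0 [mN0 PN0 subN0]] _ _ _] := bmW i.
have mEE : measurable (\bigcap_m E i m) by exact: bigcapT_measurable.
exists (N0 `|` \bigcap_m E i m); first exact: measurableU.
split.
  rewrite measureU0//.
  exact: far_up_eventually_null.
move=> w /not_orP[N0w Ew]; split.
  have : W i 0%R w = 0%R by apply: contrapT => W0; apply: N0w; exact: subN0.
  by rewrite /f /drifted normr0 mul0r subr0.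
by apply: contrapT => nm; apply: Ew => m _; apply: contrapT => Em; apply: nm; exists m.
Qed.

Let indEX i m A : measurable A ->
  P (E i m `&` X i @^-1` A) = P (E i m) * P (X i @^-1` A).
Proof.
move=> mA; case: lamQ => _ _ indep _ _.
pose G (o : option nat) := if o is Some j then E j m else X i @^-1` A.
have := indep [:: Some i; None] G.
rewrite big_cons big_seq1 /= => <-//.
- congr (P _); apply/seteqP; split => w /=.
    by move=> [Ew Xw] [j|] //=; rewrite !inE orbF => /eqP[->].
  move=> Gw; split; first by apply: (Gw (Some i)); rewrite /= !inE eqxx.
  by apply: (Gw None); rewrite /= !inE.
- move=> [j|] _ /=; first exact: far_up_sigma.
  exact: sigma_of_preimage.
Qed.

Let sumX c : \sum_(i <oo) P (X i @^-1` `]c, +oo[) = (expR (- c))%:E.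
Proof.
have := @campbell _ _ _ _ _ P _ mX _ setT pppX _ measurableT _ `]c, +oo[%classic.
rewrite probability_setT mul1e -exp_meas_itvoy => <-//.
- by apply: eq_eseriesr => i _; rewrite setTI.
- by move=> C n mC; rewrite setTI mul1e.
Qed.

(** Otherwise some point of the process at site 0 would have, with positive
    probability, a path exceeding its own maximum. *)
Lemma shape_nonpos s : grid p s -> Q [set G : grid_path p | (0 < G s)%R] = 0.
Proof.
move=> gs.
have mC : measurable [set G : grid_path p | (0 < G s)%R].
  have := measurable_eval gs measurableT (measurable_itv `]0%R, +oo[).
  by rewrite setTI; congr measurable; apply/seteqP; split => G /=;
    rewrite in_itv/= andbT.
have := slice_rect (@grid0 R p) (measurable_itv `]0%R, +oo[) mC.
rewrite exp_meas_itvoy oppr0 expR0 mul1e eseries0; last first.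
  move=> i _ _; have [N mN [PN0 goodN]] := good i.
  apply: (@subset_measure0 _ _ _ P _ N) => //.
    apply: measurableI => //; apply: measurableI.
      by rewrite -[X in measurable X]setTI; exact: mXM.
    by rewrite -[X in measurable X]setTI; exact: mF.
  move=> w [_ [_ /= Fs]]; apply: contrapT => /goodN[f0 [m nm]].
  have [gT maxT ME _] := argsup_exists p_gt0 f0 nm.
  move: Fs; rewrite /F /shapeF ltNge => /negP; apply.
  by rewrite ME subr_le0; apply: maxT; exact: gridD.
move=> /esym/eqP; rewrite mule_eq0 eqe gt_eqF//= => /eqP ->//.
Qed.

(** Each of the [2 m + 1] sites carries mass [lam * p] of points of positive
    height.  As [M >= 0], these include the points with [X > 0] and argsup in the
    window, whose mean number is at least the left-hand side. *)
Lemma lambda_lower m :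
  (1 - 2 * expR (- (p * m.+1%:R / 8)) <= lam * p * (m + m).+1%:R)%R.
Proof.
have [K1|K1] := leP (1 - 2 * expR (- (p * m.+1%:R / 8)))%R 0%R.
  by rewrite (le_trans K1)// mulr_ge0// ltW.
pose g (j : nat) : R := (p * (j%:R - m%:R))%R.
have gg j : grid p (g j).
  by exists (j%:Z - m%:Z)%R => //; rewrite intrB -!pmulrn.
pose A i := (fun w => X i w + M i w)%R @^-1` `]0%R, +oo[.
have mA i : measurable (A i) by rewrite -[A i]setTI; exact: mXM.
have mXi i : measurable (X i @^-1` `]0%R, +oo[).
  by rewrite -[X in measurable X]setTI; exact: mX.
have sumj : \sum_(j < (m + m).+1) \sum_(i <oo) P ([set w | T i w = g j] `&` A i) =
    (lam * p * (m + m).+1%:R)%:E.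
  transitivity (\sum_(j < (m + m).+1) (lam * p)%:E).
    apply: eq_bigr => j _.
    have := slice_rect (gg j) (measurable_itv `]0%R, +oo[) measurableT.
    rewrite exp_meas_itvoy oppr0 expR0 probability_setT !mule1 => <-.
    by apply: eq_eseriesr => i _; rewrite preimage_setT setIT.
  by rewrite sumEFin sumr_const card_ord mulr_natr.
rewrite -lee_fin -sumj -nneseries_sum//.
have sumXK : \sum_(i <oo) (1 - 2 * expR (- (p * m.+1%:R / 8)))%:E *
    P (X i @^-1` `]0%R, +oo[) = (1 - 2 * expR (- (p * m.+1%:R / 8)))%:E.
  by rewrite nneseriesZl// sumX oppr0 expR0 mule1.
rewrite -sumXK.
set K := (2 * expR _)%R.
have PX i : (1 - K)%:E * P (X i @^-1` `]0%R, +oo[) <=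
   \sum_(j < (m + m).+1) P ([set w | T i w = g j] `&` A i).
  have [N mN [PN0 goodN]] := good i.
  have mU : measurable (\big[setU/set0]_(j < (m + m).+1)
      ([set w | T i w = g j] `&` A i)).
    by apply: bigsetU_measurable => j _; exact: measurableI.
  apply: (@le_trans _ _ (P (N `|` \big[setU/set0]_(j < (m + m).+1)
      ([set w | T i w = g j] `&` A i)))); last first.
    apply: (le_trans (measureU2 _ _ _)) => //.
    rewrite [X in X + _](_ : _ = 0); last exact: PN0.
    rewrite add0e.
    have := @Boole_inequality _ _ _ P (fun j : nat => [set w | T i w = g j] `&` A i)
      (m + m).+1.
    by apply => j _; exact: measurableI.
  apply: (@le_trans _ _ (P (X i @^-1` `]0%R, +oo[ `\` E i m))); last first.
    apply: le_measure; rewrite ?inE.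
    - exact: measurableD.
    - exact: measurableU.
    move=> w [/= Xw Ew]; have [Nw|/goodN[f0 _]] := pselect (N w); first by left.
    right; rewrite -(bigcup_mkord _ (fun j : nat => [set w | T i w = g j] `&` A i)).
    have [[n _ nT] maxT ME Tm] := argsup_exists p_gt0 f0 Ew.
    have nm : (absz n <= m)%N.
      move: Tm; rewrite -nT normrM (gtr0_norm p_gt0) ler_pM2l// -intr_norm.
      by rewrite -abszE -pmulrn ler_nat.
    exists (absz (n + m%:Z)%R); first by rewrite /=; lia.
    split.
      rewrite /= /T -nT /g; congr (_ * _)%R.
      rewrite [X in (X - _)%R]pmulrn.
      rewrite (_ : Posz (absz (n + m%:Z)%R) = (n + m%:Z)%R); last by lia.
      by rewrite intrD -pmulrn addrK.
    move: Xw; rewrite /A /= !in_itv/= !andbT => Xw.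
    rewrite (lt_le_trans Xw)// lerDl /M ME -f0.
    by apply: maxT; exact: grid0.
  rewrite measureD//; last by rewrite ltey_eq fin_num_measure.
  have := far_up_le (bmW i) p_gt0 m; rewrite -/K.
  have := indEX i m (measurable_itv `]0%R, +oo[).
  rewrite setIC.
  have [e eE] : exists e, P (E i m) = e%:E.
    by exists (fine (P (E i m))); rewrite fineK ?fin_num_measure.
  have [x xE] : exists x, P (X i @^-1` `]0%R, +oo[) = x%:E.
    by exists (fine (P (X i @^-1` `]0%R, +oo[))); rewrite fineK ?fin_num_measure.
  move=> XE; rewrite [in X in X -> _]eE lee_fin => eK.
  have x0 : (0 <= x)%R by rewrite -lee_fin -xE.
  apply: (@le_trans _ _ (x%:E - (e * x)%:E)).
    by rewrite xE -EFinM -EFinB lee_fin mulrBl mul1r lerB// ler_wpM2r.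
  by rewrite EFinM -eE -xE -XE.
by apply: lee_nneseries => // i _ _; rewrite mule_ge0// lee_fin ltW.
Qed.

(** A point with [T = p * n] satisfies [X + M + F (- T) = X + f 0 = X].  So the
    left-hand side is the mean number of points with [X > c] and [T] at one of
    these sites.  A [T] that far out forces [far_up], which is independent of
    [X]. *)
Lemma far_slices m c (J : seq int) : uniq J -> all (fun n => m < absz n)%N J ->
  \sum_(n <- J) (lam * p)%:E * (exp_meas \x Q) (exceed p c (- (p * n%:~R))%R)
  <= (2 * expR (- (p * m.+1%:R / 8)) * expR (- c))%:E.
Proof.
move=> uJ mJ.
pose A i := X i @^-1` `]c, +oo[.
have mA i : measurable (A i) by rewrite -[A i]setTI; exact: mX.
have le_term (n : int) :
    (lam * p)%:E * (exp_meas \x Q) (exceed p c (- (p * n%:~R))%R) <=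
    \sum_(i <oo) P ([set w | T i w = (p * n%:~R)%R] `&` A i).
  have gn := gridP p n.
  have mC := @measurable_exceed _ p c _ (gridN gn).
  rewrite -(slice gn mC); apply: lee_nneseries => // i _.
  have [N mN [PN0 goodN]] := good i.
  apply: (@le_trans _ _ (P (N `|` ([set w | T i w = (p * n%:~R)%R] `&` A i)))).
    apply: le_measure; rewrite ?inE.
    - apply: measurableI => //; rewrite -[X in measurable X]setTI.
      exact: (measurable_fun_pair (mXM i) (mF i)).
    - by apply: measurableU => //; exact: measurableI.
    move=> w [/= Tw Cw]; have [Nw|/goodN[f0 [k nk]]] := pselect (N w); first by left.
    right; split => //; rewrite /A /= in_itv/= andbT.
    have [_ _ ME _] := argsup_exists p_gt0 f0 nk.
    move: Cw; rewrite /exceed /= /F /shapeF /M -Tw addNr f0.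
    by rewrite sub0r addrK.
  apply: (le_trans (measureU2 _ _ _)) => //; first exact: measurableI.
  rewrite [X in X + _](_ : _ = 0); last exact: PN0.
  by rewrite add0e.
apply: (le_trans (lee_sum _ (fun n _ => le_term n))).
rewrite -nneseries_sum//.
rewrite EFinM -sumX -nneseriesZl//; apply: lee_nneseries => [i _ _|i _].
  exact: sume_ge0.
apply: (@le_trans _ _ (P (E i m `&` A i))); last first.
  by rewrite indEX//; apply: lee_wpmul2r => //; exact: far_up_le.
have [N mN [PN0 goodN]] := good i.
have [U [mU PU subU]] : exists U, [/\ measurable U,
    P U = \sum_(n <- J) P ([set w | T i w = (p * n%:~R)%R] `&` A i) &
    forall w, U w -> A i w /\ exists2 n, n \in J & T i w = (p * n%:~R)%R].
  elim: J uJ {mJ} => [_|n J ih /= /andP[nJ uJ]].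
    by exists set0; split => //; rewrite big_nil measure0.
  have [U [mU PU subU]] := ih uJ.
  exists (([set w | T i w = (p * n%:~R)%R] `&` A i) `|` U); split.
  - by apply: measurableU => //; exact: measurableI.
  - rewrite measureU//; first by rewrite big_cons; congr (_ + _).
      exact: measurableI.
    apply/seteqP; split => // w [[/= Tn _] /subU[_ [n' n'J]]].
    rewrite Tn => /(mulfI (lt0r_neq0 p_gt0)) /eqP.
    by rewrite eqr_int => /eqP nn'; rewrite nn' n'J in nJ.
  - move=> w [[Tn Aw]|/subU[Aw [n' n'J Tn']]]; split => //.
      by exists n; rewrite ?inE ?eqxx.
    by exists n'; rewrite ?inE ?n'J ?orbT.
rewrite -PU; apply: (@le_trans _ _ (P (N `|` (E i m `&` A i)))).
  apply: le_measure; rewrite ?inE//.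
    by apply: measurableU => //; exact: measurableI.
  move=> w /subU[Aw [n nJ Tn]]; have [Nw|/goodN[f0 _]] := pselect (N w); first by left.
  right; split => //; apply: contrapT => Ew.
  have [_ _ _] := argsup_exists p_gt0 f0 Ew.
  rewrite -/(T i w) Tn normrM (gtr0_norm p_gt0) ler_pM2l// -intr_norm.
  rewrite -abszE -pmulrn ler_nat leqNgt => /negP; apply.
  exact: (allP mJ).
apply: (le_trans (measureU2 _ _ _)) => //; first exact: measurableI.
rewrite [X in X + _](_ : _ = 0); last exact: PN0.
by rewrite add0e.
Qed.

End lambda_Q.

(** * Recovering an enumeration from counts *)

Section counting_points.
Context {d' : measure_display} {Omega : Type} {S : measurableType d'}
  {R : realType}.
Variables (xi : nat -> Omega -> S) (A : set S) (w : Omega).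

Lemma dirac_bool (x : S) : \d_x A = (`[< A x >]%:R : R)%:E.
Proof.
by rewrite diracE; have [Ax|Ax] := pselect (A x);
  [rewrite mem_set// asboolT|rewrite memNset// asboolF].
Qed.

Lemma pp_count_initial (k : nat) : (forall j, A (xi j w) <-> (j < k)%N) ->
  (\sum_(i <oo) \d_(xi i w) A)%E = (k%:R)%:E :> \bar R.
Proof.
move=> Ak.
transitivity (\sum_(0 <= i < k) \d_(xi i w) A : \bar R)%E.
  apply/cvg_lim => //; apply: (@cvg_near_cst _ _ _ _ eventually).
  exists k => // n /= kn.
  rewrite (@big_cat_nat _ _ _ k 0 n)//= [X in (_ + X)%E]big_nat_cond.
  rewrite [X in (_ + X)%E]big1 ?adde0// => i.
  move=> /andP[/andP[ki _] _]; rewrite dirac_bool asboolF// => /Ak.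
  by rewrite ltnNge ki.
rewrite big_nat_cond (eq_bigr (fun=> 1%E)); last first.
  by move=> i /andP[/andP[_ ik] _]; rewrite dirac_bool asboolT//; exact/Ak.
by rewrite -big_nat_cond big_mkord sumEFin sumr_const card_ord.
Qed.

Lemma pp_count_ge (k : nat) : (forall j, (j < k)%N -> A (xi j w)) ->
  ((k%:R)%:E <= \sum_(i <oo) \d_(xi i w) A :> \bar R)%E.
Proof.
move=> Ak; apply: le_trans (nneseries_lim_ge k _) => //.
rewrite big_nat_cond (eq_bigr (fun=> 1%E)); last first.
  by move=> i /andP[/andP[_ ik] _]; rewrite dirac_bool asboolT//; exact/Ak.
by rewrite -big_nat_cond big_mkord sumEFin sumr_const card_ord.
Qed.

Lemma pp_count_neq0 : (\sum_(i <oo) \d_(xi i w) A)%E <> 0%E :> \bar R ->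
  exists j, A (xi j w).
Proof.
apply: contra_notP => nA; apply: eseries0 => i _ _; rewrite dirac_bool asboolF//.
by move=> Ai; apply: nA; exists i.
Qed.

Lemma pp_count_single i : (forall j, A (xi j w) <-> j = i) ->
  (\sum_(i <oo) \d_(xi i w) A)%E = 1%E :> \bar R.
Proof.
move=> Ai; rewrite (@nneseriesD1 _ _ i xpredT)// eseries0 ?adde0; last first.
  by move=> j _ /= ji; rewrite dirac_bool asboolF// => /Ai; apply/eqP.
by rewrite dirac_bool asboolT//; exact/Ai.
Qed.

(** Meant for half-planes above a level: when the heights decrease along the
    enumeration, the number of points above the level tells their indices. *)
Lemma pp_count_eq_initial (k : nat) :
  (forall i j, (i <= j)%N -> A (xi j w) -> A (xi i w)) ->
  (\sum_(i <oo) \d_(xi i w) A)%E = (k%:R)%:E :> \bar R ->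
  forall j, A (xi j w) <-> (j < k)%N.
Proof.
move=> Adown cnt.
have nall : exists j, `[< ~ A (xi j w) >].
  apply: contrapT => H.
  have := @pp_count_ge k.+1; rewrite cnt lee_fin ler_nat ltnn => H'; suff: false by []; apply: H'.
  by move=> j _; apply: contrapT => Aj; apply: H; exists j; apply/asboolP.
have [k' /asboolP nk' min] := ex_minnP nall.
have Ak' j : A (xi j w) <-> (j < k')%N.
  split=> [Aj|jk'].
    by rewrite ltnNge; apply/negP => k'j; apply: nk'; exact: Adown Aj.
  by apply: contrapT => /asboolP /min; rewrite leqNgt jk'.
have /eqP := pp_count_initial Ak'; rewrite cnt eqe eqr_nat => /eqP -> //.
Qed.

End counting_points.

Section ordered_points.
Context {d : measure_display} {Omega : measurableType d} {R : realType}.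
Variables (N : nat -> Omega -> R * R).

Let above (q : R) : set (R * R) := setT `*` `]q, +oo[.

(** With [i] points above [q'] and [i + 1] above [q], the point [N i] is the only
    one at a height between [q] and [q'], and counting locates it.  This turns an
    event of the enumeration into one of the point process. *)
Definition ith_in (i : nat) (A : set (R * R)) : set Omega :=
  [set w | exists q q' : rat,
    [/\ pp_count N (above (ratr q')) w = (i%:R)%:E :> \bar R,
        pp_count N (above (ratr q)) w = (i.+1%:R)%:E :> \bar R &
        pp_count N (A `&` (above (ratr q) `\` above (ratr q'))) w = 1%:E :> \bar R]].

Lemma ith_inE i A w : (forall j, (N j.+1 w).2 < (N j w).2) ->
  ith_in i A w <-> A (N i w).
Proof.
move=> Ndec.
have dec j l : (j <= l)%N -> (N l w).2 <= (N j w).2.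
  by elim: l => [|l ih]; [rewrite leqn0 => /eqP ->|
    rewrite leq_eqVlt ltnS => /predU1P[->//|/ih]; apply: le_trans; exact: ltW].
have aboveE q j : above q (N j w) <-> q < (N j w).2.
  by rewrite /above /= in_itv/= andbT; tauto.
have adown q l j : (l <= j)%N -> above q (N j w) -> above q (N l w).
  by move=> lj /aboveE qj; apply/aboveE; exact: lt_le_trans (dec _ _ lj).
split.
  move=> [q [q' [cq' cq cA]]].
  have aq' := pp_count_eq_initial (adown (ratr q')) cq'.
  have aq := pp_count_eq_initial (adown (ratr q)) cq.
  have [|j [Aj [/aq ji jq']]] := @pp_count_neq0 _ _ _ R N
      (A `&` (above (ratr q) `\` above (ratr q'))) w.
    by rewrite [X in X <> _]cA => -[] /eqP; rewrite oner_eq0.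
  have ij : (i <= j)%N by rewrite leqNgt; apply/negP => /aq'.
  by have -> : i = j by apply/eqP; rewrite eqn_leq ij -ltnS ji.
move=> Ai.
have [q qi] := rat_in_itvoo (Ndec i); rewrite in_itv/= in qi.
have [q' /andP[q'i q'i']] : exists q' : rat, ((N i w).2 < ratr q') &&
    (if i is i'.+1 then ratr q' < (N i' w).2 else true).
  case: i {Ai qi} => [|i].
    have N01 : (N 0 w).2 < (N 0 w).2 + 1 by rewrite ltrDl.
    have [q'] := rat_in_itvoo N01.
    by rewrite in_itv/= => /andP[h _]; exists q'; rewrite h.
  by have [q'] := rat_in_itvoo (Ndec i); rewrite in_itv/= => h; exists q'.
case/andP: qi => q1 q2.
have aq' j : above (ratr q') (N j w) <-> (j < i)%N.
  split=> [/aboveE q'j|ji]; last first.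
    apply/aboveE; case: i ji {Ai q1 q2 q'i} q'i' => // i ji q'i.
    exact: lt_le_trans q'i (dec j i ji).
  rewrite ltnNge; apply/negP => /dec; rewrite leNgt => /negP; apply.
  exact: lt_trans q'j.
have aq j : above (ratr q) (N j w) <-> (j < i.+1)%N.
  split=> [/aboveE qj|ji]; last by apply/aboveE; exact: lt_le_trans q2 (dec j i ji).
  rewrite ltnNge; apply/negP => /dec; rewrite leNgt => /negP; apply.
  exact: lt_trans qj.
exists q, q'; split.
- exact: pp_count_initial.
- exact: pp_count_initial.
- apply: (@pp_count_single _ _ _ _ _ _ _ i) => j; split.
    move=> [_ [/aq ji nj]]; apply/eqP; rewrite eqn_leq -ltnS ji leqNgt.
    by apply/negP => /aq'.
  move=> ->; split => //; split; first exact/aq.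
  by move=> /aq'; rewrite ltnn.
Qed.

Lemma ith_in_sigma_pp i A : measurable A -> sigma_pp R N (ith_in i A).
Proof.
move=> mA.
have mab q : measurable (above q) by exact: measurableX.
have sG := @sigma_of_algebra _ Omega _ _ _
  (measurable : set (set (R * R))) (pp_count N : _ -> _ -> \bar R).
have [_ _ sU] := sG.
have sI := @sigma_ofI _ Omega _ _ _
  (measurable : set (set (R * R))) (pp_count N : _ -> _ -> \bar R).
have s0 : sigma_pp R N set0 by case: sG.
have sc B x : measurable B -> sigma_pp R N [set w | pp_count N B w = x :> \bar R].
  move=> mB.
  exact: (@sigma_of_preimage _ _ _ _ _ measurable (pp_count N : _ -> _ -> \bar R) B [set x]).
(* Rational levels make the union countable. *)
pose E (qq : rat * rat) : set Omega := [set w |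
    [/\ pp_count N (above (ratr qq.2)) w = (i%:R)%:E :> \bar R,
        pp_count N (above (ratr qq.1)) w = (i.+1%:R)%:E :> \bar R &
        pp_count N (A `&` (above (ratr qq.1) `\` above (ratr qq.2))) w = 1%:E :> \bar R]].
have sE qq : sigma_pp R N (E qq).
  rewrite (_ : E qq = [set w | pp_count N (above (ratr qq.2)) w = (i%:R)%:E :> \bar R] `&`
    ([set w | pp_count N (above (ratr qq.1)) w = (i.+1%:R)%:E :> \bar R] `&`
     [set w | pp_count N (A `&` (above (ratr qq.1) `\` above (ratr qq.2))) w = 1%:E :> \bar R])).
    apply: (sI _ _); first exact: sc.
    apply: (sI _ _); first exact: sc.
    by apply: sc; apply: measurableI => //; exact: measurableD.
  by apply/seteqP; split => w [] => [? ? ?|? [? ?]]; split.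
rewrite (_ : ith_in i A = \bigcup_(k : nat) (if unpickle k is Some qq then E qq else set0)).
  by apply: sU => k; case: unpickle => //.
apply/seteqP; split => w.
  move=> [q [q' H]]; exists (pickle (q, q')); first exact: I.
  by rewrite pickleK; exact: H.
by move=> [k _]; case: unpickle => // -[q q'] H; exists q, q'.
Qed.

(** Where the heights decrease, [ith_in] locates every point. *)
Lemma enumeration_mod_counts (N0 : set Omega) :
  (forall w, ~ N0 w -> forall j, (N j.+1 w).2 < (N j w).2) ->
  forall B, sigma_of setT N B ->
  exists2 B', sigma_pp R N B' & forall w, ~ N0 w -> B w <-> B' w.
Proof.
move=> Ndec; apply: smallest_sub.
  have [s0 sC sU] := @sigma_of_algebra _ Omega _ _ _
    (measurable : set (set (R * R))) (pp_count N : _ -> _ -> \bar R).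
  split.
  - by exists set0.
  - move=> A [A' sA' AA']; exists (setT `\` A'); first exact: sC.
    by move=> w /AA' [h1 h2]; split => -[_ nA]; split => // ?; apply: nA; auto.
  - move=> A AA.
    have /choice[A' A'P] : forall n, exists B',
        sigma_pp R N B' /\ forall w, ~ N0 w -> A n w <-> B' w.
      by move=> n; have [B' h1 h2] := AA n; exists B'.
    exists (\bigcup_k A' k); first by apply: sU => n; have [] := A'P n.
    move=> w Nw; split => -[k _ Ak]; exists k => //;
      by have [_ /(_ w Nw) [h1 h2]] := A'P k; auto.
move=> _ [i _ [A mA <-]]; exists (ith_in i A); first exact: ith_in_sigma_pp.
by move=> w /Ndec dec; rewrite setTI; apply: iff_sym; exact: ith_inE.
Qed.

End ordered_points.

Section sigma_pp_sub.
Context {d d' : measure_display} {Omega : measurableType d}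
  {S : measurableType d'} {R : realType}.

Lemma sigma_pp_sub (xi : nat -> Omega -> S) :
  sigma_pp R xi `<=` sigma_of setT xi.
Proof.
apply: sub_sigma_of => A B mA mB.
pose Gen := \bigcup_(i in setT) preimage_set_system setT (xi i) measurable.
have mxi i : measurable_fun setT (xi i : g_sigma_algebraType Gen -> S).
  by move=> _ C mC; rewrite setTI; exact: sigma_of_preimage.
have := @pp_count_measurable _ _ (g_sigma_algebraType Gen) S R xi mxi A mA.
by move=> /(_ measurableT B mB); rewrite setTI.
Qed.

End sigma_pp_sub.

(** * The marked points of the second process *)

Section max_data.
Context {R : realType} {d : measure_display} {Omega : measurableType d}.
Variable P : probability Omega R.
Variables (p v lam : R) (Q : probability (grid_path p) R).
Variables (Rp Y rp y : nat -> Omega -> R) (F f : nat -> Omega -> grid_path p).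
Hypothesis p_gt0 : 0 < p.
Hypothesis lam_gt0 : 0 < lam.
Hypothesis data : is_max_data P v lam Q Rp Y rp y F f.
Local Open Scope ereal_scope.

Let N i w := (Rp i w, Y i w).
Let n i w := (rp i w, y i w).

Let pppN : is_PPP P N (grid_intensity (p * lam) (grid_in p v)).
Proof. by case: data => -[]. Qed.
Let pppn : is_PPP P n (grid_intensity (p * lam) (grid_out p v)).
Proof. by case: data => _ []. Qed.

Let mN i : measurable_fun setT (N i).
Proof. by case: pppN. Qed.
Let mn i : measurable_fun setT (n i).
Proof. by case: pppn. Qed.
Let mF i : measurable_fun setT (F i).
Proof. by case: data => _ _ _ /(_ i) [[]]. Qed.
Let mf i : measurable_fun setT (f i).
Proof. by case: data => _ _ _ /(_ i) [_ []]. Qed.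
Let lawf i B : measurable B -> P (f i @^-1` B) = Q B.
Proof. by case: data => _ _ _ /(_ i) [_ [_ +]] _; apply. Qed.

Let points (ci : nat + nat) := match ci with inl i => N i | inr i => n i end.

Let G (o : option (nat + nat)) : set (set Omega) :=
  match o with
  | None => sigma_of setT points
  | Some (inl i) => sigma_of [set tt] (fun _ => F i)
  | Some (inr i) => sigma_of [set tt] (fun _ => f i)
  end.

Let indG : mutual_indep P G.
Proof. by case: data. Qed.

Let GI o : setI_closed (G o).
Proof. by case: o => [[i|i]|]; exact: sigma_ofI. Qed.
Let GT o : G o setT.
Proof. by case: o => [[i|i]|]; exact: sigma_ofT. Qed.
Let Gm o : G o `<=` measurable.
Proof.
case: o => [[i|i]|]; apply: sigma_of_measurable => //.
by case=> i _; [exact: mN|exact: mn].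
Qed.

Let indNn A H : sigma_pp R N A -> sigma_pp R n H -> P (A `&` H) = P A * P H.
Proof.
move=> sA sH; case: data => _ _ /(_ [:: true; false] (fun c => if c then A else H)) + _ _.
rewrite big_cons big_seq1 /= => <-//; last by case.
congr (P _); apply/seteqP; split => w /=.
  by move=> [Aw Hw] [] _.
by move=> AHw; split; [exact: (AHw true)|exact: (AHw false)].
Qed.

(** The enumeration is included, and not only the point process, since the
    conditioning event refers to the [k] highest points. *)
Definition first_info : set (set Omega) :=
  <<s sigma_of setT N `|` \bigcup_(i in setT) sigma_of [set tt] (fun _ : unit => F i) >>.

Let G_points : sigma_of setT N `<=` G None.
Proof.
apply: sub_sigma_of => i A _ mA.
exact: (@sigma_of_preimage _ _ _ _ _ setT points (inl i)).
Qed.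

Let G_points' : sigma_of setT n `<=` G None.
Proof.
apply: sub_sigma_of => i A _ mA.
exact: (@sigma_of_preimage _ _ _ _ _ setT points (inr i)).
Qed.

Let GF := <<s \bigcup_(i in setT) sigma_of [set tt] (fun _ : unit => F i) >>.

Let GF_alg : sigma_algebra setT GF.
Proof. exact: smallest_sigma_algebra. Qed.

Let GFI : setI_closed GF.
Proof. by have /sigma_algebraP[//|_ _ _] := GF_alg. Qed.

Let GF_T : GF setT.
Proof. by have /sigma_algebraP[//|? _ _] := GF_alg. Qed.

Let GF_m : GF `<=` measurable.
Proof.
apply: smallest_sub; first exact: sigma_algebra_measurable.
by move=> A [i _ GA]; exact: (@Gm (Some (inl i)) A GA).
Qed.

Let GF_sub : GF `<=` <<s \bigcup_(o in [set o | exists i, o = Some (inl i)]) G o >>.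
Proof.
apply: (sub_bigcup_sigma (h := fun i => Some (inl i))) => i _; split => //.
by exists i.
Qed.

Let ind_points_F A B : G None A -> GF B -> P (A `&` B) = P A * P B.
Proof.
move=> GA GB.
apply: (@mutual_indep_groups _ _ _ P _ G GI GT Gm [set None]
  [set o | exists i, o = Some (inl i)] indG) => //.
- by move=> o -> [i].
- by apply: sub_sigma_algebra; exists None.
- exact: GF_sub.
Qed.

Lemma null_decreasing : exists2 N0, measurable N0 /\ P N0 = 0 &
  forall w, ~ N0 w -> forall j, (Y j.+1 w < Y j w)%R.
Proof.
case: data => -[_ _ [N0 [mN0 PN0 subN0]]] _ _ _ _; exists N0 => // w N0w.
by apply: contrapT => nY; apply: N0w; exact: subN0.
Qed.

Let ind_N_n A H : sigma_of setT N A -> sigma_pp R n H ->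
  P (A `&` H) = P A * P H.
Proof.
move=> sA sH; have [N0 [mN0 PN0] decN0] := null_decreasing.
have [A' sA' AA'] := @enumeration_mod_counts _ _ _ N N0 decN0 A sA.
have mA : measurable A by apply: (@Gm None _ (G_points sA)).
have mA' : measurable A'.
  by apply: (@Gm None _ (G_points _)); exact: sigma_pp_sub sA'.
have mH : measurable H.
  by apply: (@Gm None _ (G_points' _)); exact: sigma_pp_sub sH.
have eqP0 C C' : measurable C -> measurable C' ->
    (forall w, ~ N0 w -> C w <-> C' w) -> P C = P C'.
  move=> mC mC' CC'.
  have PD D : measurable D -> P D = P (D `\` N0).
    move=> mD; rewrite measureD//; last by rewrite ltey_eq fin_num_measure.
    rewrite [X in _ = _ - X](_ : _ = 0) ?sube0//.
    by apply: (subset_measure0 _ mN0 _ PN0); [exact: measurableI|exact: subIsetr].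
  rewrite PD// [RHS]PD//; congr (P _); apply/seteqP.
  by split => w [Cw Nw]; split => //; apply/(CC' w Nw).
rewrite (eqP0 (A `&` H) (A' `&` H)); last 3 first.
- exact: measurableI.
- exact: measurableI.
- by move=> w /AA' [h1 h2]; split => -[? ?]; split => //; auto.
by rewrite indNn// (eqP0 A A').
Qed.

(** The paths are independent of all points, and the enumeration of the first
    process is determined by its counts up to null sets, so the independence of
    the two point processes suffices. *)
Lemma first_info_indep B H : first_info B -> sigma_pp R n H ->
  P (B `&` H) = P B * P H.
Proof.
move=> iB sH.
pose Pi := [set A : set Omega | exists N' F', [/\ sigma_of setT N N', GF F' & A = N' `&` F']].
have mH : measurable H.
  by apply: (@Gm None _ (G_points' _)); exact: sigma_pp_sub sH.
apply: (@indep_generated _ _ _ P Pi H) => //.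
- move=> _ _ [N1 [F1 [sN1 sF1 ->]]] [N2 [F2 [sN2 sF2 ->]]].
  exists (N1 `&` N2), (F1 `&` F2); split; last by rewrite setIACA.
    exact: sigma_ofI.
  exact: GFI.
- move=> _ [N1 [F1 [sN1 sF1 ->]]]; apply: measurableI; last exact: GF_m.
  exact: (@Gm None _ (G_points sN1)).
- move=> _ [N1 [F1 [sN1 sF1 ->]]].
  have GN1 := G_points sN1.
  have GH := G_points' (sigma_pp_sub sH).
  rewrite setIAC ind_points_F//; last exact: (GI GN1 GH).
  by rewrite ind_N_n// [P (N1 `&` F1)]ind_points_F// muleAC.
- move: iB; apply: smallest_sub; first exact: smallest_sigma_algebra.
  move=> A [sA|[i _ sA]]; apply: sub_sigma_algebra.
    by exists A, setT; rewrite setIT.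
  exists setT, A; rewrite setTI; split => //; first exact: sigma_ofT.
  by apply: sub_sigma_algebra; exists i.
Qed.

Lemma first_info_measurable : first_info `<=` measurable.
Proof.
apply: smallest_sub; first exact: sigma_algebra_measurable.
move=> A [/G_points GA|[i _ GA]]; first exact: (@Gm None A GA).
exact: (@Gm (Some (inl i)) A GA).
Qed.

Let first_info_sub : first_info `<=`
  <<s \bigcup_(o in [set o | o = None \/ exists i, o = Some (inl i)]) G o >>.
Proof.
apply: sub_sigma_algebra2 => A [sA|[i _ sA]].
  by exists None; [left|exact: G_points].
by exists (Some (inl i)) => //; right; exists i.
Qed.

(** The event [B] is independent of the counts of the second process, and the
    path at a point is independent of both, so [P B] factors out of the mean.
    Counts have to be used, as the enumeration of the second process may depend
    on the first. *)
Lemma second_slices B r C : first_info B -> 0 < P B -> grid_out p v r ->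
  measurable C ->
  \sum_(j <oo) P ((B `&` [set w | rp j w = r]) `&` [set w | C (y j w, f j w)]) =
  P B * ((lam * p)%:E * (exp_meas \x Q) C).
Proof.
move=> iB PB gr mC; have mB := first_info_measurable iB.
have mgo : measurable (grid_out p v).
  by apply: measurableD; [exact: measurable_grid|exact: measurable_itv].
have pl0 : (0 < p * lam)%R by exact: mulr_gt0.
have mrp j : measurable_fun setT (rp j).
  exact: (measurableT_comp measurable_fst (mn j)).
have my j : measurable_fun setT (y j).
  exact: (measurableT_comp measurable_snd (mn j)).
have [b bE] : exists b, P B = b%:E.
  by exists (fine (P B)); rewrite fineK ?fin_num_measure.
have b0 : (0 < b)%R by rewrite -lte_fin -bE.
rewrite muleA bE -EFinM.
apply: (@series_joint_law _ _ _ _ _ P Q (b * (lam * p))%R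
  (fun j => B `&` [set w | rp j w = r]) y f) => //.
- by rewrite mulr_gt0// mulrC.
- move=> j; apply: measurableI => //.
  by have := mrp j measurableT _ (measurable_set1 r); rewrite setTI.
move=> A A' mA mA'.
have ind j : P ((B `&` [set w | rp j w = r]) `&` (y j @^-1` A `&` f j @^-1` A')) =
    P (B `&` n j @^-1` ([set r] `*` A)) * Q A'.
  rewrite -(lawf j mA').
  rewrite -(@mutual_indep_groups _ _ _ P _ G GI GT Gm
    [set o | o = None \/ exists i, o = Some (inl i)] [set Some (inr j)] indG) => //.
  + by congr (P _); apply/seteqP; split => w /=; tauto.
  + by move=> o [->|[i ->]].
  + have /sigma_algebraP[//|_ _ _] := @smallest_sigma_algebra _ setT
      (\bigcup_(o in [set o | o = None \/ exists i, o = Some (inl i)]) G o).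
    apply; first exact: first_info_sub.
    apply: sub_sigma_algebra; exists None; first by left.
    apply: G_points'; apply: sigma_of_preimage => //.
    exact: measurableX.
  + apply: sub_sigma_algebra; exists (Some (inr j)) => //.
    exact: (@sigma_of_preimage _ _ _ _ _ _ _ tt).
under eq_eseriesr do rewrite ind muleC.
have [q qE] : exists q, Q A' = q%:E.
  by exists (fine (Q A')); rewrite fineK ?fin_num_measure.
rewrite qE nneseriesZl//.
have := @campbell _ _ _ _ _ P n mn _ B pppn _ mB _ ([set r] `*` A).
rewrite bE => -> //.
- rewrite (grid_intensity_slice (ltW pl0) mgo)// (mulrC p lam).
  by rewrite muleC [in RHS]EFinM -!muleA.
- by move=> C' mC'; exact: (grid_intensity_ge0 (ltW pl0) mgo).
- move=> C' k mC'; rewrite -bE; apply: first_info_indep => //.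
  exact: (@sigma_of_preimage _ _ _ _ _ measurable (pp_count n : _ -> _ -> \bar R) C' [set _]).
- exact: measurableX.
Qed.

End max_data.

(** * Measurability of the maximum process *)

Section measurable_max_process.
Context {d : measure_display} {Omega : measurableType d} {R : realType}.
Variable p : R.

(** Grid points are indexed by integers, and conditions on all or some of them
    are countable combinations. *)
Lemma measurable_bigcup_int (S : int -> set Omega) :
  (forall n, measurable (S n)) -> measurable (\bigcup_n S n).
Proof.
move=> mS; rewrite (_ : \bigcup_n S n =
    \bigcup_(k : nat) (if unpickle k is Some n then S n else set0)).
  by apply: bigcupT_measurable => k; case: unpickle.
apply/seteqP; split => w.
  move=> [n _ Sn]; exists (pickle n); first exact: I.
  by rewrite pickleK; exact: Sn.
by move=> [k _]; case: unpickle => // n Sn; exists n.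
Qed.

Lemma measurable_bigcap_int (S : int -> set Omega) :
  (forall n, measurable (S n)) -> measurable (\bigcap_n S n).
Proof.
move=> mS; rewrite -[X in measurable X]setCK setC_bigcap.
by apply: measurableC; apply: measurable_bigcup_int => n; exact: measurableC.
Qed.

Lemma measurable_shifted_eval (Rp : Omega -> R) (F : Omega -> grid_path p) t :
  measurable_fun setT Rp -> measurable_fun setT F ->
  (forall w, grid p (Rp w)) -> grid p t ->
  measurable_fun setT (fun w => F w (t - Rp w)).
Proof.
move=> mR mF gR gt _ B mB; rewrite setTI.
rewrite (_ : _ @^-1` B = \bigcup_(n : int)
    (Rp @^-1` [set p * n%:~R] `&` (fun w => F w (t - p * n%:~R)) @^-1` B)).
  apply: measurable_bigcup_int => n; apply: measurableI.
    by have := mR measurableT _ (measurable_set1 (p * n%:~R)); rewrite setTI.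
  have gn : grid p (t - p * n%:~R) by apply: gridB => //; exact: gridP.
  have := measurableT_comp (measurable_eval gn) mF measurableT mB.
  by rewrite setTI.
apply/seteqP; split => w /=.
  by have [n _ nR] := gR w => FB; exists n => //=; rewrite nR.
by move=> [n _ [/= -> ]].
Qed.

Section first_process.
Variables (Rp Y : nat -> Omega -> R) (F : nat -> Omega -> grid_path p).
Hypothesis mR : forall i, measurable_fun setT (Rp i).
Hypothesis mY : forall i, measurable_fun setT (Y i).
Hypothesis mF : forall i, measurable_fun setT (F i).
Hypothesis gR : forall i w, grid p (Rp i w).

Lemma measurable_point_value t i : grid p t ->
  measurable_fun setT (fun w => (Y i w + F i w (t - Rp i w))%:E).
Proof.
move=> gt; apply/measurable_EFinP; apply: measurable_funD => //.
exact: measurable_shifted_eval.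
Qed.

Lemma measurable_Zk t k : grid p t -> measurable_fun setT (Zk k Rp Y F t).
Proof.
move=> gt; elim: k => [|k ih].
  rewrite (_ : Zk 0 Rp Y F t = cst -oo%E)//.
  by apply/funext => w; rewrite /Zk big_ord0.
rewrite (_ : Zk k.+1 Rp Y F t =
    fun w => maxe (Zk k Rp Y F t w) (Y k w + F k w (t - Rp k w))%:E).
  by apply: measurable_maxe => //; exact: measurable_point_value.
by apply/funext => w; rewrite /Zk big_ord_recr.
Qed.

Lemma measurable_sup_points t : grid p t ->
  measurable_fun setT (fun w =>
    ereal_sup (range (fun i => (Y i w + F i w (t - Rp i w))%:E))).
Proof.
move=> gt.
have := @measurable_fun_esups _ _ _ setT
  (fun i w => (Y i w + F i w (t - Rp i w))%:E)
  (fun i => measurable_point_value i gt) 0%N.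
congr (measurable_fun _ _); apply/funext => w; rewrite /esups /=; congr ereal_sup.
by apply/seteqP; split => _ [i _ <-]; exists i.
Qed.

(** [Ck] is an infimum over countably many sites; a strict lower bound leaves a
    margin [1 / (m + 1)]. *)
Lemma measurable_conditioning b k c : (0 < k)%N ->
  measurable [set w | Y k.-1 w <= c /\ (c%:E < Ck b k Rp Y F w)%E].
Proof.
move=> k0; rewrite (_ : [set w | _] = Y k.-1 @^-1` `]-oo, c] `&`
    \bigcup_(m : nat) \bigcap_(l : int) [set w | `|p * l%:~R| <= b ->
       ((c + m.+1%:R^-1)%:E <= Zk k Rp Y F (p * l%:~R)%R w)%E]).
  apply: measurableI; first by rewrite -[X in measurable X]setTI; exact: mY.
  apply: bigcupT_measurable => m; apply: measurable_bigcap_int => l.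
  have [lb|lb] := pselect (`|p * l%:~R| <= b); last first.
    rewrite (_ : [set w | _] = setT)//.
    by apply/seteqP; split => [//|w _ /= /lb].
  rewrite (_ : [set w | _] = setT `&` [set w |
      ((c + m.+1%:R^-1)%:E <= Zk k Rp Y F (p * l%:~R)%R w)%E]).
    by apply: emeasurable_fun_c_infty => //; apply: measurable_Zk; exact: gridP.
  by apply/seteqP; split => w /=; [move=> /(_ lb)|move=> []].
apply/seteqP; split => w /=; rewrite in_itv/= => -[Yc Cc]; split => //.
  have [m cm] : exists m : nat, ((c + m.+1%:R^-1)%:E <= Ck b k Rp Y F w)%E.
    case: (Ck b k Rp Y F w) Cc => [x| |]//; last by exists 0%N; rewrite leey.
    rewrite lte_fin => cx; have xc : 0 < x - c by rewrite subr_gt0.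
    exists (Num.bound (x - c)^-1); rewrite lee_fin -lerBrDl.
    rewrite invf_ple ?posrE ?ltr0n// ltW//.
    rewrite (lt_trans (archi_boundP _)) ?invr_ge0 1?ltW// ltr_nat//.
  exists m => // l _ /= lb; apply: (le_trans cm); apply: ereal_inf_lbound.
  exists (p * l%:~R) => //; split; first exact: gridP.
  by rewrite /= in_itv/= -ler_norml.
have [m _ mP] := Cc.
apply: (@lt_le_trans _ _ (c + m.+1%:R^-1)%:E).
  by rewrite lte_fin ltrDl invr_gt0.
apply: le_ereal_inf_tmp => _ [t [[l _ <-] lb] <-]; apply: mP => //.
by move: lb; rewrite /= in_itv/= -ler_norml.
Qed.

End first_process.

Section both_processes.
Variables (Rp Y rp y : nat -> Omega -> R) (F f : nat -> Omega -> grid_path p).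
Hypothesis mR : forall i, measurable_fun setT (Rp i).
Hypothesis mY : forall i, measurable_fun setT (Y i).
Hypothesis mF : forall i, measurable_fun setT (F i).
Hypothesis gR : forall i w, grid p (Rp i w).
Hypothesis mr : forall i, measurable_fun setT (rp i).
Hypothesis my : forall i, measurable_fun setT (y i).
Hypothesis mf : forall i, measurable_fun setT (f i).
Hypothesis gr : forall i w, grid p (rp i w).

Lemma measurable_Zfull t : grid p t -> measurable_fun setT (Zfull Rp Y rp y F f t).
Proof.
by move=> gt; apply: measurable_maxe; exact: measurable_sup_points.
Qed.

Lemma measurable_Zneq b k : measurable [set w | exists2 t, grid_in p b t &
  Zk k Rp Y F t w != Zfull Rp Y rp y F f t w].
Proof.
rewrite (_ : [set w | _] = \bigcup_(l : int) [set w | `|p * l%:~R| <= b /\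
    Zk k Rp Y F (p * l%:~R) w != Zfull Rp Y rp y F f (p * l%:~R) w]).
  apply: measurable_bigcup_int => l.
  have [lb|lb] := pselect (`|p * l%:~R| <= b); last first.
    by rewrite (_ : [set w | _] = set0)//; apply/seteqP; split => w // [].
  rewrite (_ : [set w | _] = setT `&` [set w |
      Zk k Rp Y F (p * l%:~R) w != Zfull Rp Y rp y F f (p * l%:~R) w]).
    apply: emeasurable_fun_neq => //.
      by apply: measurable_Zk => //; exact: gridP.
    by apply: measurable_Zfull; exact: gridP.
  by apply/seteqP; split => w /= [].
apply/seteqP; split => w.
  move=> [t [[l _ <-] lb] H]; exists l => //; split => //.
  by move: lb; rewrite /= in_itv/= -ler_norml.
move=> [l _ [lb H]]; exists (p * l%:~R) => //; split; first exact: gridP.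
by rewrite /= in_itv/= -ler_norml.
Qed.

End both_processes.

End measurable_max_process.

(** * The union bound *)

Section deterministic.
Context {d : measure_display} {Omega : measurableType d} {R : realType} (p : R).
Variables (Rp Y rp y : nat -> Omega -> R) (F f : nat -> Omega -> grid_path p).

Lemma Zk_ge k t w i : (i < k)%N ->
  ((Y i w + F i w (t - Rp i w))%:E <= Zk k Rp Y F t w)%E.
Proof.
by move=> ik; exact: (le_bigmax _ (fun i : 'I_k => (Y i w + F i w (t - Rp i w))%:E) (Ordinal ik)).
Qed.

Lemma Zk_le_Zfull k t w : (Zk k Rp Y F t w <= Zfull Rp Y rp y F f t w)%E.
Proof.
apply: bigmax_le => [|i _]; first exact: leNye.
by rewrite le_max; apply/orP; left; apply: ereal_sup_ubound; exists i.
Qed.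

(** Paths below 0 of points at heights at most [c] stay below [c], so only a
    point of the second process can change the maximum. *)
Lemma exceed_of_neq k t w c :
  (0 < k)%N ->
  (forall i, Y i.+1 w < Y i w) ->
  (forall i, F i w (t - Rp i w) <= 0) ->
  Y k.-1 w <= c -> (c%:E < Zk k Rp Y F t w)%E ->
  Zk k Rp Y F t w != Zfull Rp Y rp y F f t w ->
  exists j, c < y j w + f j w (t - rp j w).
Proof.
move=> k0 Ydec F0 Yc cZ ZZ.
have : (Zk k Rp Y F t w < Zfull Rp Y rp y F f t w)%E.
  by rewrite lt_neqAle ZZ Zk_le_Zfull.
rewrite /Zfull lt_max => /orP[] /ereal_sup_gt[_ [i _ <-]] Zi; last first.
  by exists i; rewrite -lte_fin (lt_trans cZ).
have [ik|ki] := ltnP i k; first by rewrite ltNge Zk_ge in Zi.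
have : c < Y i w + F i w (t - Rp i w) by rewrite -lte_fin (lt_trans cZ).
have dec j : Y (k.-1 + j)%N w <= Y k.-1 w.
  by elim: j => [|j ih]; rewrite ?addn0// addnS (le_trans (ltW (Ydec _))).
have := dec (i - k.-1)%N; rewrite subnKC; last by lia.
have := F0 i; lra.
Qed.

End deterministic.

Lemma null_bigcup {d : measure_display} {Omega : measurableType d} {R : realType}
    (P : probability Omega R) (S : nat -> set Omega) :
  (forall k, measurable (S k)) -> (forall k, P (S k) = 0) ->
  P (\bigcup_k S k) = 0.
Proof.
move=> mS PS; apply/eqP; rewrite eq_le measure_ge0 andbT.
apply: (@le_trans _ _ (\sum_(k <oo) P (S k))%E).
  by apply: measure_sigma_subadditive => //; exact: bigcup_measurable.
by rewrite eseries0// => k _ _; exact: PS.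
Qed.

Section union_bound.
Context {R : realType}.
Context {d0 : measure_display} {Omega0 : measurableType d0}.
Variables (P0 : probability Omega0 R).
Variables (W : nat -> R -> Omega0 -> R) (X : nat -> Omega0 -> R).
Context {d : measure_display} {Omega : measurableType d}.
Variable P : probability Omega R.
Variables (p b v c lam : R) (Q : probability (grid_path p) R) (k : nat).
Variables (Rp Y rp y : nat -> Omega -> R) (F f : nat -> Omega -> grid_path p).
Hypothesis p_gt0 : 0 < p.
Hypothesis k_gt0 : (0 < k)%N.
Hypothesis lamQ : is_lambda_Q P0 W X lam Q.
Hypothesis data : is_max_data P v lam Q Rp Y rp y F f.
Variables (V L : nat).
Hypothesis vV : v = p * V%:R.
Hypothesis LV : (L <= V)%N.
Hypothesis bL : forall l : int, `|p * l%:~R| <= b -> (absz l <= L)%N.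
Local Open Scope ereal_scope.

Let A := [set w | exists2 t, grid_in p b t &
       Zk k Rp Y F t w != Zfull Rp Y rp y F f t w].
Let B := [set w | (Y k.-1 w <= c)%R /\ (c%:E < Ck b k Rp Y F w)%E].

Let lam_gt0 : (0 < lam)%R. Proof. by case: lamQ. Qed.

Let mN i : measurable_fun setT (fun w => (Rp i w, Y i w)).
Proof. by case: data => -[_ [H _ _ _] _] *; exact: H. Qed.
Let mn i : measurable_fun setT (fun w => (rp i w, y i w)).
Proof. by case: data => _ [_ [H _ _ _]] *; exact: H. Qed.
Let mRp i : measurable_fun setT (Rp i).
Proof. exact: (measurableT_comp measurable_fst (mN i)). Qed.
Let mY i : measurable_fun setT (Y i).
Proof. exact: (measurableT_comp measurable_snd (mN i)). Qed.
Let mrp i : measurable_fun setT (rp i).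
Proof. exact: (measurableT_comp measurable_fst (mn i)). Qed.
Let my i : measurable_fun setT (y i).
Proof. exact: (measurableT_comp measurable_snd (mn i)). Qed.
Let mF i : measurable_fun setT (F i).
Proof. by case: data => _ _ _ /(_ i) [[]]. Qed.
Let mf i : measurable_fun setT (f i).
Proof. by case: data => _ _ _ /(_ i) [_ []]. Qed.
Let gRp i w : grid p (Rp i w).
Proof. by case: data => -[/(_ i w) [H _]] *. Qed.
Let grp i w : grid_out p v (rp i w).
Proof. by case: data => _ [/(_ i w) H _] *. Qed.

Let mA : measurable A.
Proof. by apply: measurable_Zneq => // i w; have [] := grp i w. Qed.

Let mB : measurable B.
Proof. exact: measurable_conditioning. Qed.

Let infoB : first_info Rp Y F B.
Proof.
pose Gen := sigma_of setT (fun i w => (Rp i w, Y i w)) `|`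
  \bigcup_(i in setT) sigma_of [set tt] (fun _ : unit => F i).
have mN' i : measurable_fun setT
    ((fun w => (Rp i w, Y i w)) : g_sigma_algebraType Gen -> (R * R)%type).
  move=> _ C mC; rewrite setTI; apply: sub_sigma_algebra; left.
  exact: (@sigma_of_preimage _ _ _ _ _ setT (fun i w => (Rp i w, Y i w))).
have mF' i : measurable_fun setT (F i : g_sigma_algebraType Gen -> grid_path p).
  move=> _ C mC; rewrite setTI; apply: sub_sigma_algebra; right; exists i => //.
  exact: (@sigma_of_preimage _ _ _ _ _ _ _ tt).
exact: (@measurable_conditioning _ (g_sigma_algebraType Gen) R p Rp Y F
  (fun i => measurableT_comp measurable_fst (mN' i))
  (fun i => measurableT_comp measurable_snd (mN' i)) mF' gRp b k c k_gt0).
Qed.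

Let null_nonpos : exists2 N1, measurable N1 /\ P N1 = 0 &
  forall w, ~ N1 w -> forall i s, grid p s -> (F i w s <= 0)%R.
Proof.
have mS i (n : int) : measurable [set w | (0 < F i w (p * n%:~R))%R].
  have := measurableT_comp (measurable_eval (gridP p n)) (mF i) measurableT
    (measurable_itv `]0%R, +oo[).
  by rewrite setTI; congr measurable; apply/seteqP; split => w /=;
    rewrite in_itv/= andbT.
have PS i (n : int) : P [set w | (0 < F i w (p * n%:~R))%R] = 0.
  have mC : measurable [set G : grid_path p | (0 < G (p * n%:~R))%R].
    have := measurable_eval (gridP p n) measurableT (measurable_itv `]0%R, +oo[).
    by rewrite setTI; congr measurable; apply/seteqP; split => G /=;
      rewrite in_itv/= andbT.
  rewrite -(shape_nonpos p_gt0 lamQ (gridP p n)).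
  by case: data => _ _ _ /(_ i) [[_ law] _] _; exact: law.
pose S i (h : nat) := if unpickle h is Some n then
  [set w | (0 < F i w (p * n%:~R))%R] else set0.
have mSS i h : measurable (S i h) by rewrite /S; case: unpickle.
have PSS i h : P (S i h) = 0 by rewrite /S; case: unpickle.
exists (\bigcup_i \bigcup_h S i h).
  split; first by apply: bigcupT_measurable => i; exact: bigcupT_measurable.
  apply: null_bigcup => i; first exact: bigcupT_measurable.
  exact: null_bigcup.
move=> w Nw i s [n _ <-]; rewrite leNgt; apply/negP => Fs; apply: Nw.
exists i; first exact: I.
by exists (pickle n); [exact: I|rewrite /S pickleK].
Qed.

Let hit (l n : int) (j : nat) : set Omega :=
  (B `&` [set w | rp j w = (p * n%:~R)%R]) `&`
  [set w | exceed p c (p * l%:~R - p * n%:~R)%R (y j w, f j w)].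

Let mhit l n j : measurable (hit l n j).
Proof.
apply: measurableI.
  apply: measurableI => //.
  by have := mrp j measurableT (measurable_set1 (p * n%:~R)%R); rewrite setTI.
have gln : grid p (p * l%:~R - p * n%:~R)%R by apply: gridB; exact: gridP.
rewrite -[X in measurable X]setTI.
exact: (measurable_fun_pair (my j) (mf j) measurableT (measurable_exceed _ gln)).
Qed.

Let grid_outE (n : int) : grid_out p v (p * n%:~R)%R <-> (V < absz n)%N.
Proof.
have -> : (V < absz n)%N = ~~ (`|(p * n%:~R : R)%R| <= v)%R.
  rewrite vV normrM (gtr0_norm p_gt0) ler_pM2l// -intr_norm -abszE -pmulrn.
  by rewrite ler_nat ltnNge.
split.
  by move=> [_ /= nv]; apply/negP => h; apply: nv; rewrite in_itv/= -ler_norml.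
move=> /negP nv; split; first exact: gridP.
by rewrite /= in_itv/= -ler_norml.
Qed.

Let slice (n : int) : \bar R :=
  (lam * p)%:E * (exp_meas \x Q) (exceed p c (- (p * n%:~R))%R).

Let P_hit (l n : int) : 0 < P B -> (V < absz n)%N ->
  P (\bigcup_j hit l n j) <= P B * slice (n - l)%R.
Proof.
move=> PB Vn.
apply: (@le_trans _ _ (\sum_(j <oo) P (hit l n j))).
  by apply: measure_sigma_subadditive => //; exact: bigcup_measurable.
have gln : grid p (p * l%:~R - p * n%:~R)%R by apply: gridB; exact: gridP.
rewrite (second_slices p_gt0 lam_gt0 data infoB PB ((grid_outE n).2 Vn)
  (measurable_exceed c gln)).
by rewrite /slice intrB mulrBr opprB.
Qed.

Let slice_ge0 n : 0 <= slice n.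
Proof. by rewrite mule_ge0// lee_fin mulr_ge0// ltW. Qed.

Let K := (2 * expR (- (p * (V - L).+1%:R / 8)) * expR (- c))%R.

Let side (l : int) (i : nat) : set Omega :=
  (\bigcup_j hit l (V.+1 + i)%N j) `|` (\bigcup_j hit l (- (V.+1 + i)%N%:Z)%R j).

Let mside l i : measurable (side l i).
Proof. by apply: measurableU; exact: bigcupT_measurable. Qed.

(** Only the difference [n - l] matters, and it exceeds [V - L] in absolute value
    for the sites of rank above [V]. *)
Let P_sides (l : int) : 0 < P B -> (absz l <= L)%N ->
  P (\bigcup_i side l i) <= P B * K%:E.
Proof.
move=> PB lL.
apply: (@le_trans _ _ (\sum_(i <oo) P (side l i))).
  by apply: measure_sigma_subadditive => //; exact: bigcup_measurable.
apply: lime_le; first exact: is_cvg_nneseries.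
apply: nearW => M.
pose pos (i : nat) : int := ((V.+1 + i)%N%:Z - l)%R.
pose neg (i : nat) : int := (- (V.+1 + i)%N%:Z - l)%R.
pose J := [seq pos i | i <- index_iota 0 M] ++ [seq neg i | i <- index_iota 0 M].
have uJ : uniq J.
  rewrite cat_uniq !map_inj_uniq ?iota_uniq/=; last 2 first.
  - by move=> i j; rewrite /pos /neg => ?; lia.
  - by move=> i j; rewrite /pos /neg => ?; lia.
  rewrite andbT; apply/hasPn => _ /mapP[i _ ->]; apply/negP => /mapP[j _].
  by rewrite /pos /neg => ?; lia.
have JVL : all (fun n => V - L < absz n)%N J.
  by rewrite all_cat; apply/andP; split; apply/allP => _ /mapP[i _ ->];
    rewrite /pos /neg /=; lia.
apply: (@le_trans _ _ (P B * \sum_(n <- J) slice n)); last first.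
  apply: lee_wpmul2l; first exact: measure_ge0.
  exact: (far_slices p_gt0 lamQ _ uJ JVL).
rewrite big_cat/= !big_map ge0_muleDr ?sume_ge0//.
rewrite !ge0_sume_distrr// -big_split/=.
apply: lee_sum => i _; rewrite /side.
apply: (le_trans (measureU2 _ _ _)) => //; try exact: bigcupT_measurable.
by apply: leeD; apply: P_hit => //; lia.
Qed.

Let cover : exists2 N, measurable N /\ P N = 0 &
  A `&` B `<=` N `|` \bigcup_(l < (L + L).+1) \bigcup_i side (l%:Z - L%:Z)%R i.
Proof.
have [N0 [mN0 PN0] decN0] := null_decreasing data.
have [N1 [mN1 PN1] npN1] := null_nonpos.
exists (N0 `|` N1).
  split; first exact: measurableU.
  by rewrite measureU0.
move=> w [[_ [[l _ <-] lb] ZZ] [Yc cC]].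
have [N0w|N0w] := pselect (N0 w); first by left; left.
have [N1w|N1w] := pselect (N1 w); first by left; right.
have gl := gridP p l.
have lb' : (`|p * l%:~R| <= b)%R by move: lb; rewrite /= in_itv/= -ler_norml.
have cZ : c%:E < Zk k Rp Y F (p * l%:~R)%R w.
  by apply: (lt_le_trans cC); apply: ereal_inf_lbound; exists (p * l%:~R)%R.
have [i|j cj] := exceed_of_neq k_gt0 (decN0 w N0w) _ Yc cZ ZZ.
  by apply: npN1 => //; exact: gridB.
have [n _ nr] := (grp j w).1.
have nV : (V < absz n)%N.
  by apply: (grid_outE n).1; rewrite [(p * _)%R]nr; exact: grp.
have hitj : hit l n j w.
  split; last by rewrite /= /exceed/= nr.
  by split; [split|rewrite /= nr].
have lL := bL lb'.
right; exists (absz (l + L%:Z)%R); first by rewrite /=; lia.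
rewrite (_ : (absz (l + L%:Z))%:Z - L%:Z = l)%R; last by lia.
exists (absz n - V.+1)%N; first exact: I.
have [n0|n0] := leP 0%R n.
  left; exists j; first exact: I.
  by rewrite (_ : (V.+1 + (absz n - V.+1))%N%:Z = n)//; lia.
right; exists j; first exact: I.
by rewrite (_ : - (V.+1 + (absz n - V.+1))%N%:Z = n)%R//; lia.
Qed.

(** The window of radius [b] has at most [2 L + 1] grid points, and each of them
    costs at most [K]. *)
Lemma union_bound : 0 < P B ->
  P (A `&` B) <= P B * ((L + L).+1%:R * K)%:E.
Proof.
move=> PB; have [N [mNull PN] sub] := cover.
have mU (l : nat) : measurable (\bigcup_i side (l%:Z - L%:Z)%R i).
  exact: bigcupT_measurable.
have mUU : measurable (\bigcup_(l < (L + L).+1) \bigcup_i side (l%:Z - L%:Z)%R i).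
  by apply: bigcup_measurable.
apply: (@le_trans _ _ (P (N `|` \bigcup_(l < (L + L).+1) \bigcup_i side (l%:Z - L%:Z)%R i))).
  by apply: le_measure; rewrite ?inE//; [exact: measurableI|exact: measurableU].
apply: (le_trans (measureU2 _ _ _)) => //.
rewrite [X in X + _](_ : _ = 0); last exact: PN.
rewrite add0e bigcup_mkord.
have := @Boole_inequality _ _ _ P (fun l : nat => \bigcup_i side (l%:Z - L%:Z)%R i) (L + L).+1.
move=> /(_ (fun l _ => mU l)) /le_trans; apply.
apply: (@le_trans _ _ (\sum_(l < (L + L).+1) P B * K%:E)).
  apply: lee_sum => l _; apply: P_sides => //.
  by have := ltn_ord l; lia.
rewrite -ge0_sume_distrr; last first.
  by move=> i _; rewrite lee_fin !mulr_ge0// expR_ge0.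
by rewrite sumEFin sumr_const card_ord mulr_natl.
Qed.

End union_bound.

(** * Numerical comparison *)

Section numeric.
Context {R : realType}.
Implicit Types x y z p b D u : R.

Lemma expR_ge_sqr x : 0 <= x -> (1 + x / 2) ^+ 2 <= expR x.
Proof.
move=> x0; rewrite [in leRHS](_ : x = x / 2 + x / 2); last by field.
rewrite expRD -expr2 ler_sqr ?nnegrE ?expR_ge0//; last by lra.
exact: expR_ge1Dx.
Qed.

Lemma expR2_ge7 : 7 <= expR 2 :> R.
Proof.
have -> : 2 = 64%:R * (1 / 32) :> R by field.
have h : (33 / 32 : R) <= expR (1 / 32) by have := expR_ge1Dx (1 / 32 : R); lra.
have h7 : 7 <= (33 / 32 : R) ^+ 64 by lra.
rewrite expRM_natl (le_trans h7)// lerXn2r ?nnegrE ?expR_ge0//; lra.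
Qed.

Lemma expRN32_le : 2 * expR (- (3 / 2)) <= 1 / 2 :> R.
Proof.
have e4 : 4 <= expR (3 / 2) :> R.
  have -> : 3 / 2 = 12%:R * (1 / 8) :> R by field.
  have h : (9 / 8 : R) <= expR (1 / 8) by have := expR_ge1Dx (1 / 8 : R); lra.
  have h4 : 4 <= (9 / 8 : R) ^+ 12 by lra.
  rewrite expRM_natl (le_trans h4)// lerXn2r ?nnegrE ?expR_ge0//; lra.
have := expR_gt0 (3 / 2 : R) => e0.
by rewrite expRN ler_pdivrMr//; lra.
Qed.

Lemma pi_lt4 : pi < 4 :> R.
Proof. by have := @pihalf_lt2 R; lra. Qed.

(** For [y = sqrt D - 4] and [u = 1 - exp (- p / 2)] this is the comparison left
    after division by [exp (- D / 8)]; small [p] is handled by [u <= p / 2], large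
    [p] by [u <= 1]. *)
Lemma core_small_b p b y u : 0 < p -> 0 < b -> b < 2 -> 0 < y ->
  p <= b + (y + 4) ^+ 2 -> 0 < u -> u <= 1 -> u <= p / 2 ->
  (2 * b / p + 1) * (24 + p) * u ^+ 2 <= 78 * (1 + y / 2) ^+ 2.
Proof.
move=> p0 b0 b2 y0 pb u0 u1 up.
have y1 : 78 <= 78 * (1 + y / 2) ^+ 2 by nra.
have bp : 2 * b / p <= 4 / p by rewrite ler_pM2r ?invr_gt0//; lra.
have uu : 0 <= u ^+ 2 by rewrite exprn_ge0// ltW.
apply: (@le_trans _ _ ((4 / p + 1) * (24 + p) * u ^+ 2)).
  by apply: ler_wpM2r => //; apply: ler_wpM2r; [lra|rewrite lerD2r].
have [p2|p2] := leP p 2.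
  apply: le_trans y1.
  apply: (@le_trans _ _ ((4 / p + 1) * (24 + p) * (p / 2) ^+ 2)).
    apply: ler_wpM2l; last by rewrite ler_sqr ?nnegrE; lra.
    by rewrite mulr_ge0// ?addr_ge0// ?divr_ge0//; lra.
  rewrite (_ : (4 / p + 1) * _ * _ = (4 + p) * (24 + p) * p / 4); last by field; lra.
  by nra.
apply: (@le_trans _ _ ((4 / p + 1) * (24 + p))).
  rewrite ler_piMr//; last by rewrite exprn_ile1// ltW.
  by rewrite mulr_ge0// ?addr_ge0// ?divr_ge0//; lra.
have [p48|p48] := leP p 48.
  apply: le_trans y1.
  rewrite (_ : (4 / p + 1) * _ = (4 + p) * (24 + p) / p); last by field; lra.
  by rewrite ler_pdivrMr//; nra.
apply: (@le_trans _ _ (30 + p)); last by nra.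
rewrite (_ : (4 / p + 1) * _ = (4 + p) * (24 + p) / p); last by field; lra.
by rewrite ler_pdivrMr//; nra.
Qed.

(** Here the number of grid points in the window grows with [b]; the term
    [28 * b] is four times the factor of [last_term_ge]. *)
Lemma core_large_b p b y u : 0 < p -> 2 <= b -> 0 < y ->
  p <= b + (y + 4) ^+ 2 -> 0 < u -> u <= 1 -> u <= p / 2 ->
  (2 * b / p + 1) * (24 + p) * u ^+ 2 <= 78 * (1 + y / 2) ^+ 2 + 28 * b.
Proof.
move=> p0 b2 y0 pb u0 u1 up.
have uu : u ^+ 2 <= u by rewrite expr2 ler_piMr// ltW.
have u2p : u ^+ 2 / p <= 1 / 2.
  by rewrite ler_pdivrMr//; lra.
rewrite (_ : _ * _ = 48 * b * (u ^+ 2 / p) + (2 * b + 24 + p) * u ^+ 2); last by field; lra.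
apply: (@le_trans _ _ (48 * b * (1 / 2) + (2 * b + 24 + p) * 1)).
  by apply: lerD; apply: ler_wpM2l => //; lra.
by nra.
Qed.

(** The sum in parentheses in the bound, with [D = v - b]. *)
Definition tail_sum b D : R :=
  expR (- Num.sqrt D)
  + 8 / Num.sqrt (2 * pi) * (1 + 1 / (Num.sqrt D - 4)) *
      expR (- ((Num.sqrt D - 4) ^+ 2 / 8))
  + 100 * Num.sqrt (b ^+ 3) / (9 * Num.sqrt pi) *
      expR (- ((Num.sqrt D - ln (Num.sqrt D)) ^+ 2 / (4 * b))).

Let sqrtD4 D : 16 < D -> 4 < Num.sqrt D.
Proof.
by move=> D16; rewrite -(ltr_sqr (x := 4)) ?nnegrE ?sqrtr_ge0// sqr_sqrtr; lra.
Qed.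

(** The Gaussian term alone dominates [exp (- D / 8)] with room to spare:
    its exponent is [- D / 8 + sqrt D - 2]. *)
Lemma gaussian_term_ge D : 16 < D ->
  (39 / 2) * (1 + (Num.sqrt D - 4) / 2) ^+ 2 * expR (- (D / 8)) <=
  8 / Num.sqrt (2 * pi) * (1 + 1 / (Num.sqrt D - 4)) *
      expR (- ((Num.sqrt D - 4) ^+ 2 / 8)).
Proof.
move=> D16; have z4 := sqrtD4 D16.
have zz : Num.sqrt D ^+ 2 = D by rewrite sqr_sqrtr//; lra.
set y := Num.sqrt D - 4; have y0 : 0 < y by rewrite subr_gt0.
have pi0 := @pi_gt0 R; have pi4 := pi_lt4.
have spi0 : 0 < Num.sqrt (2 * pi : R) by rewrite sqrtr_gt0 mulr_gt0.
have c28 : 28 / 10 <= 8 / Num.sqrt (2 * pi : R).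
  have s2 : Num.sqrt (2 * pi : R) <= 20 / 7.
    by rewrite -ler_sqr ?nnegrE ?sqrtr_ge0// sqr_sqrtr; lra.
  by rewrite ler_pdivlMr//; lra.
rewrite (_ : - (y ^+ 2 / 8) = 2 + y - D / 8); last first.
  by rewrite -zz /y; field.
rewrite (expRD (2 + y)) (expRD 2 y) !mulrA ler_wpM2r ?expR_ge0//.
have iy : 0 < 1 / y by rewrite divr_gt0.
have e7 := expR2_ge7; have ey : (1 + y / 2) ^+ 2 <= expR y by exact/expR_ge_sqr/ltW.
have h1 : 28 / 10 * 1 <= 8 / Num.sqrt (2 * pi) * (1 + 1 / y).
  by apply: ler_pM => //; lra.
have h2 : 7 * (1 + y / 2) ^+ 2 <= expR 2 * expR y.
  by apply: ler_pM => //; exact: sqr_ge0.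
rewrite -[leRHS]mulrA; apply: (@le_trans _ _ (28 / 10 * 1 * (7 * (1 + y / 2) ^+ 2))).
  by have := sqr_ge0 (1 + y / 2); lra.
apply: ler_pM; [lra| |exact: h1|exact: h2].
by apply: mulr_ge0 => //; exact: sqr_ge0.
Qed.

(** Since [0 <= ln (sqrt D) <= sqrt D], the exponent is at least [- D / (4 b)]. *)
Lemma last_term_ge b D : 16 < D -> 2 <= b ->
  7 * b * expR (- (D / 8)) <= 100 * Num.sqrt (b ^+ 3) / (9 * Num.sqrt pi) *
      expR (- ((Num.sqrt D - ln (Num.sqrt D)) ^+ 2 / (4 * b))).
Proof.
move=> D16 b2; have z4 := sqrtD4 D16.
have zz : Num.sqrt D ^+ 2 = D by rewrite sqr_sqrtr//; lra.
have pi0 := @pi_gt0 R; have pi4 := pi_lt4.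
have spi0 : 0 < Num.sqrt (pi : R) by rewrite sqrtr_gt0.
have spi2 : Num.sqrt (pi : R) <= 2.
  by rewrite -(ler_sqr (x := Num.sqrt _)) ?nnegrE ?sqrtr_ge0// sqr_sqrtr; lra.
have sb : 14 / 10 * b <= Num.sqrt (b ^+ 3).
  rewrite -ler_sqr ?nnegrE ?sqrtr_ge0//; last by lra.
  rewrite sqr_sqrtr ?exprn_ge0//; last by lra.
  rewrite exprMn [leRHS]exprS ler_wpM2r ?sqr_ge0//; lra.
apply: ler_pM; rewrite ?expR_ge0//; first by lra.
  rewrite ler_pdivlMr ?mulr_gt0//.
  apply: (@le_trans _ _ (7 * b * (9 * 2))); last by lra.
  by apply: ler_wpM2l; lra.
rewrite ler_expR lerN2.
have l0 : 0 <= ln (Num.sqrt D) by apply: ln_ge0; lra.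
have lz : ln (Num.sqrt D) < Num.sqrt D by apply: ln_sublinear; lra.
have sq : (Num.sqrt D - ln (Num.sqrt D)) ^+ 2 <= D.
  by rewrite -[leRHS]zz ler_sqr ?nnegrE; lra.
rewrite ler_pdivrMr; last by lra.
by apply: (le_trans sq); nra.
Qed.

Lemma tail_sum_ge b D p u : 0 < p -> 0 < b -> 16 < D -> p <= b + D ->
  0 < u -> u <= 1 -> u <= p / 2 ->
  (2 * b / p + 1) * (24 + p) * u ^+ 2 * expR (- (D / 8)) <= 4 * tail_sum b D.
Proof.
move=> p0 b0 D16 pD u0 u1 up.
have z4 := sqrtD4 D16.
have zz : Num.sqrt D ^+ 2 = D by rewrite sqr_sqrtr//; lra.
have y0 : 0 < Num.sqrt D - 4 by rewrite subr_gt0.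
have pD' : p <= b + (Num.sqrt D - 4 + 4) ^+ 2 by rewrite subrK zz.
have g := gaussian_term_ge D16.
have e1 := expR_gt0 (- Num.sqrt D); have eD := expR_gt0 (- (D / 8)).
rewrite /tail_sum.
have [b2|b2] := ltP b 2.
  have third : 0 <= 100 * Num.sqrt (b ^+ 3) / (9 * Num.sqrt pi) *
      expR (- ((Num.sqrt D - ln (Num.sqrt D)) ^+ 2 / (4 * b))).
    by rewrite mulr_ge0 ?expR_ge0// divr_ge0 ?mulr_ge0 ?sqrtr_ge0.
  have := ler_wpM2r (ltW eD) (core_small_b p0 b0 b2 y0 pD' u0 u1 up).
  by lra.
have l := last_term_ge D16 b2.
have := ler_wpM2r (ltW eD) (core_large_b p0 b2 y0 pD' u0 u1 up).
by lra.
Qed.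

End numeric.

(** * The conditional probability *)

(** The argsup lies within distance about 12 of the origin with probability at
    least 1/2, and a grid point carries at most [lam * p] of it. *)
Lemma lambda_ge {R : realType} {d : measure_display} {Omega : measurableType d}
    (P : probability Omega R) (W : nat -> R -> Omega -> R) (X : nat -> Omega -> R)
    (p lam : R) (Q : probability (grid_path p) R) : 0 < p ->
  is_lambda_Q P W X lam Q -> 1 <= 2 * (24 + p) * lam.
Proof.
move=> p0 lamQ; have lam0 : 0 < lam by case: lamQ.
(* The choice of 12 makes [2 * exp (- 12 / 8)] at most 1/2. *)
pose m := Num.truncn (12 / p).
have /andP[m1 m2] : (m%:R <= 12 / p < m.+1%:R).
  by apply: truncn_itv; rewrite divr_ge0// ltW.
rewrite ler_pdivlMr// in m1; rewrite ltr_pdivrMr// in m2.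
have := lambda_lower p0 lamQ m.
have : expR (- (p * m.+1%:R / 8)) <= expR (- (3 / 2)) :> R.
  by rewrite ler_expR lerN2; lra.
have := @expRN32_le R.
rewrite -(natr1 (m + m)) natrD => e1 e2 le.
have : lam * (p * (m%:R + m%:R + 1)) <= lam * (24 + p).
  by rewrite ler_pM2l//; lra.
by lra.
Qed.

(** The window has at most [2 b / p + 1] grid points, and [p * (V - L + 1)] is at
    least [v - b]. *)
Lemma tail_bound {R : realType} (p b v lam : R) (V L : nat) :
  0 < p -> 0 < b -> b + 16 < v -> v = p * V%:R -> (L <= V)%N ->
  p * L%:R <= b -> 0 < lam -> 1 <= 2 * (24 + p) * lam ->
  (L + L).+1%:R * (2 * expR (- (p * (V - L).+1%:R / 8))) <=
  16 * (1 - expR (- (p / 2))) ^- 2 * lam * tail_sum b (v - b).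
Proof.
move=> p0 b0 bv vV LV Lb lam0 lam1.
set D := v - b; have D16 : 16 < D by rewrite /D; lra.
set u := 1 - expR (- (p / 2)).
have u0 : 0 < u by rewrite subr_gt0 expR_lt1 oppr_lt0; lra.
have u1 : u <= 1 by rewrite lerBlDr lerDl expR_ge0.
have up : u <= p / 2 by have := expR_ge1Dx (- (p / 2)); rewrite /u; lra.
have V0 : (0 < V)%N by rewrite -(ltr0n R) -(pmulr_rgt0 _ p0) -vV; lra.
have pD : p <= b + D.
  by rewrite /D vV subrKC; apply: ler_peMr; [exact: ltW|rewrite ler1n].
have ts := tail_sum_ge p0 b0 D16 pD u0 u1 up.
have eD : expR (- (p * (V - L).+1%:R / 8)) <= expR (- (D / 8)).
  rewrite ler_expR lerN2 ler_wpM2r// -natr1 natrB// mulrDr mulrBr -vV /D; lra.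
have Lp : (L + L).+1%:R <= 2 * b / p + 1 :> R.
  rewrite -natr1 natrD lerD2r ler_pdivlMr//; lra.
have T0 : 0 <= tail_sum b D.
  rewrite -(pmulr_rge0 (x := 4))//; apply: le_trans ts.
  apply: mulr_ge0; last exact: expR_ge0.
  apply: mulr_ge0; last exact: sqr_ge0.
  have bp0 : 0 <= 2 * b / p by apply: divr_ge0; lra.
  by apply: mulr_ge0; lra.
have u20 : 0 < u ^+ 2 by rewrite exprn_gt0.
apply: (@le_trans _ _ ((2 * b / p + 1) * (2 * expR (- (D / 8))))).
  by apply: ler_pM; rewrite ?mulr_ge0 ?expR_ge0// ler_pM2l.
rewrite (_ : 16 * u ^- 2 * lam * _ = (16 * lam * tail_sum b D) / u ^+ 2); last first.
  by rewrite -!mulrA; congr (_ * _); rewrite mulrC -!mulrA.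
rewrite ler_pdivlMr//.
have p24 : 0 < 24 + p by lra.
rewrite -(ler_pM2r p24).
apply: (@le_trans _ _ (8 * tail_sum b D)).
  by move: ts; rewrite -(ler_pM2l (_ : 0 < 2))//; lra.
have : tail_sum b D * 1 <= tail_sum b D * (2 * (24 + p) * lam) by rewrite ler_wpM2l.
by lra.
Qed.

Unset Implicit Arguments.

Theorem proposition3p14 (R : realType)
  (d0 : measure_display) (Omega0 : measurableType d0)
  (P0 : probability Omega0 R)
  (W : nat -> R -> Omega0 -> R) (X : nat -> Omega0 -> R)
  (p b v : R) (k : nat) (c : R)
  (lam : R) (Q : probability (grid_path p) R)
  (d : measure_display) (Omega : measurableType d) (P : probability Omega R)
  (Rp Y rp y : nat -> Omega -> R) (F f : nat -> Omega -> grid_path p)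
  (hp : 0 < p) (hb : 0 < b) (hv : grid p v) (hvb : b + 16 < v)
  (hk : (0 < k)%N) (hc : c < 0)
  (hlamQ : is_lambda_Q P0 W X lam Q)
  (hdata : is_max_data P v lam Q Rp Y rp y F f) :
  cond_prob P
    [set w | exists2 t, grid_in p b t &
       Zk k Rp Y F t w != Zfull Rp Y rp y F f t w]
    [set w | Y k.-1 w <= c /\ (c%:E < Ck b k Rp Y F w)%E]
  <= 16 * expR (- c) * (1 - expR (- (p / 2))) ^- 2 * lam *
     ( expR (- Num.sqrt (v - b))
     + 8 / Num.sqrt (2 * pi) * (1 + 1 / (Num.sqrt (v - b) - 4)) *
         expR (- ((Num.sqrt (v - b) - 4) ^+ 2 / 8))
     + 100 * Num.sqrt (b ^+ 3) / (9 * Num.sqrt pi) *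
         expR (- ((Num.sqrt (v - b) - ln (Num.sqrt (v - b))) ^+ 2 / (4 * b)))).
Proof.
have [V vV] : exists V : nat, v = p * V%:R.
  case: hv => [[V|V] _ vV]; first by exists V; rewrite -vV.
  by exfalso; move: hvb; rewrite -vV NegzE mulrNz mulrN => hvb;
    have : 0 <= p * V.+1%:R by [rewrite mulr_ge0// ltW]; rewrite -pmulrn in hvb; lra.
pose L := Num.truncn (b / p).
have /andP[L1 L2] : (L%:R <= b / p < L.+1%:R).
  by apply: truncn_itv; rewrite divr_ge0// ltW.
rewrite ler_pdivlMr// mulrC in L1; rewrite ltr_pdivrMr// mulrC in L2.
have LV : (L <= V)%N.
  by rewrite -(ler_nat R) -(ler_pM2l hp) -vV; lra.
have bL (l : int) : `|p * l%:~R| <= b -> (absz l <= L)%N.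
  rewrite normrM (gtr0_norm hp) -intr_norm -abszE -pmulrn => lb.
  by rewrite -ltnS -(ltr_nat R) -(ltr_pM2l hp); exact: le_lt_trans L2.
have lam0 : 0 < lam by case: hlamQ.
have := tail_bound hp hb hvb vV LV L1 lam0 (lambda_ge hp hlamQ).
have UB := union_bound hp hk hlamQ hdata vV LV bL.
move=> /(ler_wpM2l (expR_ge0 (- c))) TB.
set A := [set w | exists2 t, _ & _]; set B := [set w | _ /\ _].
rewrite -[X in _ <= _ * X]/(tail_sum b (v - b)).
apply: (@le_trans _ _ ((L + L).+1%:R *
    (2 * expR (- (p * (V - L).+1%:R / 8)) * expR (- c)))); last by lra.
set K := (X in _ <= X); rewrite /cond_prob.
have K0 : 0 <= K by rewrite /K !mulr_ge0// expR_ge0.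
have [PB0|PB0] := eqVneq (P B) 0; first by rewrite PB0 invr0 mulr0.
have PB : (0 < P B)%E by rewrite lt0e PB0 measure_ge0.
have := UB c PB; rewrite -/A -/B; have := measure_ge0 P (A `&` B).
(* The quotient is 0 by convention unless [P B] is positive and finite. *)
case: (P B) PB => [r| |] // PB; last by rewrite invr0 mulr0.
rewrite -EFinM; case: (P (A `&` B)) => [x| |] //= _; last by rewrite mul0r.
by rewrite lee_fin ler_pdivrMr// mulrC.
Qed.
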